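(* Let $n\ge1$, $\sigma=\{\sigma_1,\dots,\sigma_n\}$, let $k$ be a $\sigma$-field, and let $G$ be a $\sigma$-algebraic group over $k$ that is a $\sigma$-closed subgroup of an algebraic group over $k$. The degree and the leading coefficient of the dimension polynomial of the Zariski closures of $G$ depend only on $G$, and not on the choice of algebraic group $\mathcal{G}$ or of $\sigma$-closed embedding $G\hookrightarrow\mathcal{G}$. That is: if $\mathcal{G}$ and $\mathcal{G}'$ are algebraic groups over $k$, if $G\hookrightarrow\mathcal{G}$ and $G\hookrightarrow\mathcal{G}'$ are $\sigma$-closed embeddings of $\sigma$-algebraic groups, if $(G[i])_{i\in\mathbb{N}}$ and $(G'[i])_{i\in\mathbb{N}}$ are the Zariski closures of $G$ with respect to $\mathcal{G}$ and $\mathcal{G}'$ respectively, and if $\phi,\phi'\in\mathbb{Q}[t]$ are the polynomials with $\phi(i)=\dim(G[i])$ and $\phi'(i)=\dim(G'[i])$ for all large enough $i\in\mathbb{N}$, then $\phi$ and $\phi'$ have the same degree and the same leading coefficient.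
   Context: All rings are commutative with unit; $\mathbb{N}=\{0,1,2,\dots\}$. A $\sigma$-ring is a ring with $n$ pairwise commuting ring endomorphisms $\sigma_1,\dots,\sigma_n$; a $\sigma$-field is a $\sigma$-ring that is a field. A $k$-$\sigma$-algebra is a $\sigma$-ring $R$ that is a $k$-algebra via a ring morphism $k\to R$ commuting with all $\sigma_j$; morphisms are $k$-algebra morphisms commuting with all $\sigma_j$. $T_\sigma$ is the free commutative monoid of formal monomials $\tau=\sigma_1^{k_1}\cdots\sigma_n^{k_n}$, $\operatorname{ord}(\tau)=k_1+\dots+k_n$, $T_\sigma[i]=\{\tau\mid\operatorname{ord}(\tau)\le i\}$. A $k$-$\sigma$-algebra is finitely $\sigma$-generated if it is generated as a $k$-algebra by $\{\tau(f)\mid \tau\in T_\sigma,f\in F\}$ for some finite subset $F$. A $k$-$\sigma$-Hopf algebra is a commutative $k$-Hopf algebra that is a $k$-$\sigma$-algebra whose structure maps commute with the $\sigma_j$; a $\sigma$-Hopf ideal is a Hopf ideal closed under all $\sigma_j$. A $\sigma$-algebraic group over $k$ is a functor from $k$-$\sigma$-algebras to groups represented by a finitely $\sigma$-generated $k$-$\sigma$-algebra $k\{G\}$ (which is then a $k$-$\sigma$-Hopf algebra); a morphism $G\to H$ (natural transformation respecting the group structure) corresponds dually to a morphism $k\{H\}\to k\{G\}$ of $k$-$\sigma$-Hopf algebras, and is a $\sigma$-closed embedding if it induces an isomorphism onto its image, i.e. onto the $\sigma$-closed subgroup of $H$ defined by the kernel of the dual map; equivalently, if the dual map is surjective. An algebraic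 group over $k$ is an affine group scheme of finite type over $k$. For $\tau\in T_\sigma$, ${}^\tau\mathcal{G}$ is the base change of $\mathcal{G}$ along $\tau\colon k\to k$, with coordinate ring $k[\mathcal{G}]\otimes_kk$ (formed via $\tau$ on the right factor; $k$-algebra via the right factor). Put $\mathcal{G}[i]=\prod_{\tau\in T_\sigma[i]}{}^\tau\mathcal{G}$, $k[\mathcal{G}[i]]=\bigotimes_{\tau\in T_\sigma[i]}k[{}^\tau\mathcal{G}]\subseteq k[\mathcal{G}[i+1]]$, and $k\{\mathcal{G}\}=\bigcup_ik[\mathcal{G}[i]]$, a $k$-$\sigma$-Hopf algebra in which $\sigma_j$ sends $r\otimes\lambda$ in the $\tau$-factor to $r\otimes\sigma_j(\lambda)$ in the $\sigma_j\tau$-factor. It represents the $\sigma$-algebraic group $[\sigma]_k\mathcal{G}$, $R\mapsto\mathcal{G}(R)$, which is also simply denoted $\mathcal{G}$. Given a $\sigma$-closed embedding $G\hookrightarrow\mathcal{G}$ with dual map $k\{\mathcal{G}\}\to k\{G\}$ with kernel $\mathbb{I}(G)$, the Zariski closures of $G$ with respect to $\mathcal{G}$ are the closed subgroups $G[i]\le\mathcal{G}[i]$ defined by the Hopf ideals $\mathbb{I}(G)\cap k[\mathcal{G}[i]]$. The dimension of an algebraic group is the Krull dimension of its coordinate ring. It is known that there is a polynomial (the dimension polynomial) in $\mathbb{Q}[t]$ of degree at most $n$ that agrees with $\dim(G[i])$ for all large $i$. *)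

(* Defs.v *)
From HB Require Import structures.
From mathcomp Require Import all_boot all_order all_algebra.
From mathcomp Require Import boolp.

Set Implicit Arguments.
Unset Strict Implicit.
Unset Printing Implicit Defensive.

Import GRing.Theory.
Local Open Scope ring_scope.
Local Open Scope quotient_scope.

Local Obligation Tactic := try by [].


(* Rings are [comPzRingType]s: the zero ring is allowed, in particular among
   the algebras on which group functors are evaluated. *)

Record ideal (R : comPzRingType) := Ideal {
  ideal_pred :> {pred R};
  ideal0 : 0 \in ideal_pred;
  idealD : {in ideal_pred &, forall x y, x + y \in ideal_pred};
  idealMl : forall a, {in ideal_pred, forall x, a * x \in ideal_pred} }.

Section IdealQuotient.
Variables (R : comPzRingType) (I : ideal R).

Lemma ideal_zmod_closed : zmod_closed (I : {pred R}).
Proof.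
split=> [|x y Ix Iy]; first exact: ideal0.
by apply: idealD => //; rewrite -mulN1r; apply: idealMl.
Qed.

Definition ideal_zmod : zmodClosed R :=
  HB.pack (fun x => x \in I) (GRing.isZmodClosed.Build R _ ideal_zmod_closed).

Definition ideal_quot := Quotient.quot ideal_zmod.
HB.instance Definition _ := GRing.Zmodule.on ideal_quot.

Definition ideal_pi (x : R) : ideal_quot := \pi_(Quotient.quot ideal_zmod) x.

Lemma ideal_piP x y : reflect (ideal_pi x = ideal_pi y) (x - y \in I).
Proof.
have -> : (x - y \in I) = (ideal_pi x == ideal_pi y) by exact: (Quotient.idealrBE ideal_zmod x y).
exact: eqP.
Qed.

Lemma ideal_pi_repr (q : ideal_quot) : ideal_pi (repr q) = q.
Proof. exact: reprK. Qed.

Lemma ideal_piB : {morph ideal_pi : x y / x - y}.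
Proof. by move=> x y; apply: (raddfB \pi_(Quotient.quot ideal_zmod)). Qed.

Definition ideal_quot_one : ideal_quot := ideal_pi 1.
Definition ideal_quot_mul (x y : ideal_quot) : ideal_quot :=
  ideal_pi (repr x * repr y).

Lemma ideal_piM x y : ideal_pi (x * y) = ideal_quot_mul (ideal_pi x) (ideal_pi y).
Proof.
apply/ideal_piP; set x' := repr _; set y' := repr _.
have Ix : x - x' \in I by apply/ideal_piP; rewrite ideal_pi_repr.
have Iy : y - y' \in I by apply/ideal_piP; rewrite ideal_pi_repr.
have -> : x * y - x' * y' = y * (x - x') + x' * (y - y').
  by rewrite !mulrBr addrA [y * x']mulrC subrK [y * x]mulrC.
by apply: idealD; apply: idealMl.
Qed.

Lemma ideal_quot_mulA : associative ideal_quot_mul.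
Proof.
move=> x y z; rewrite -[x]ideal_pi_repr -[y]ideal_pi_repr -[z]ideal_pi_repr.
by rewrite -!ideal_piM mulrA.
Qed.

Lemma ideal_quot_mulC : commutative ideal_quot_mul.
Proof.
move=> x y; rewrite -[x]ideal_pi_repr -[y]ideal_pi_repr.
by rewrite -!ideal_piM mulrC.
Qed.

Lemma ideal_quot_mul1 : left_id ideal_quot_one ideal_quot_mul.
Proof. by move=> x; rewrite -[x]ideal_pi_repr -!ideal_piM mul1r. Qed.

Lemma ideal_piD : {morph ideal_pi : x y / x + y}.
Proof. by move=> x y; apply: (raddfD \pi_(Quotient.quot ideal_zmod)). Qed.

Lemma ideal_quot_mulDl : left_distributive ideal_quot_mul +%R.
Proof.
move=> x y z; rewrite -[x]ideal_pi_repr -[y]ideal_pi_repr -[z]ideal_pi_repr.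
by rewrite -ideal_piD -!ideal_piM -ideal_piD mulrDl.
Qed.

HB.instance Definition _ := GRing.Zmodule_isComPzRing.Build ideal_quot
  ideal_quot_mulA ideal_quot_mulC ideal_quot_mul1 ideal_quot_mulDl.

Lemma ideal_pi_zmod_morphism : zmod_morphism ideal_pi.
Proof. exact: ideal_piB. Qed.
Lemma ideal_pi_monoid_morphism : monoid_morphism ideal_pi.
Proof. by split=> // x y; rewrite ideal_piM. Qed.
HB.instance Definition _ :=
  GRing.isZmodMorphism.Build R ideal_quot ideal_pi ideal_pi_zmod_morphism.
HB.instance Definition _ :=
  GRing.isMonoidMorphism.Build R ideal_quot ideal_pi ideal_pi_monoid_morphism.

End IdealQuotient.

Program Definition ideal_preim (R S : comPzRingType) (f : {rmorphism R -> S})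
    (J : ideal S) : ideal R := @Ideal R [pred x | f x \in J] _ _ _.
Next Obligation. by move=> R S f J; rewrite inE rmorph0 ideal0. Qed.
Next Obligation.
by move=> R S f J x y; rewrite !inE rmorphD => Jx Jy; apply: idealD.
Qed.
Next Obligation.
by move=> R S f J a x; rewrite !inE rmorphM => Jx; apply: idealMl.
Qed.

Program Definition ker (R S : comPzRingType) (f : {rmorphism R -> S}) : ideal R :=
  @Ideal R [pred x | f x == 0] _ _ _.
Next Obligation. by move=> R S f; rewrite inE rmorph0. Qed.
Next Obligation.
by move=> R S f x y; rewrite !inE rmorphD => /eqP-> /eqP->; rewrite addr0.
Qed.
Next Obligation. by move=> R S f a x; rewrite !inE rmorphM => /eqP->; rewrite mulr0. Qed.

Definition prime_ideal (R : comPzRingType) (P : ideal R) : Prop :=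
  1 \notin P /\ forall x y, x * y \in P -> (x \in P) || (y \in P).

Definition prime_chain (R : comPzRingType) (d : nat) (P : 'I_d.+1 -> ideal R) :=
  (forall i, prime_ideal (P i)) /\
  (forall i j : 'I_d.+1, (i < j)%N ->
     {subset P i <= P j} /\ exists2 x, x \in P j & x \notin P i).

Definition has_krull_dim (R : comPzRingType) (d : nat) : Prop :=
  (exists P, @prime_chain R d P) /\
  (forall e P, @prime_chain R e P -> (e <= d)%N).

Section Algebras.
Variable k : fieldType.

Record kalg := KAlg {
  kalg_ring :> comPzRingType;
  kalg_map : {rmorphism k -> kalg_ring} }.

Record khom (A B : kalg) := KHom {
  khom_fun :> {rmorphism A -> B};
  khom_map : forall c, khom_fun (kalg_map A c) = kalg_map B c }.

Lemma rmorphism_eq (R S : pzRingType) (f g : {rmorphism R -> S}) : f =1 g -> f = g.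
Proof.
case: f g => [f [[fA] [fM]]] [g [[gA] [gM]]] /= /funext efg.
by subst g; rewrite (Prop_irrelevance fA gA) (Prop_irrelevance fM gM).
Qed.

Lemma khom_eq (A B : kalg) (f g : khom A B) : f =1 g -> f = g.
Proof.
case: f g => [f fP] [g gP] /= /rmorphism_eq efg.
by subst g; rewrite (Prop_irrelevance fP gP).
Qed.

Program Definition khom_id (A : kalg) : khom A A := @KHom A A idfun _.

Program Definition khom_comp (A B C : kalg) (g : khom B C) (f : khom A B) : khom A C :=
  @KHom A C (g \o f) _.
Next Obligation. by move=> A B C g f c; rewrite /= !khom_map. Qed.

(* [B] with its scalars restricted along an endomorphism of [k] *)
Definition krestrict (tau : {rmorphism k -> k}) (B : kalg) : kalg :=
  @KAlg B (kalg_map B \o tau).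

Inductive in_subalg (A : kalg) (X : A -> Prop) : A -> Prop :=
| in_subalg_gen x of X x : in_subalg X x
| in_subalg_const c : in_subalg X (kalg_map A c)
| in_subalg_add x y of in_subalg X x & in_subalg X y : in_subalg X (x + y)
| in_subalg_mul x y of in_subalg X x & in_subalg X y : in_subalg X (x * y).

Definition finitely_generated (A : kalg) : Prop :=
  exists F : seq A, forall a, in_subalg (fun x => x \in F) a.

End Algebras.

Section Tensor.
Variables (k : fieldType) (I : Type) (A : I -> kalg k).

(* The tensor product over k of an arbitrary family of commutative k-algebras
   (for an infinite family: the union of the finite tensor products), presented
   by generators and relations; see [tens_lift] and [tens_ext] for its
   universal property. *)
Inductive tterm :=
| TConst of k
| TGen i of A i
| TAdd of tterm & tterm
| TOpp of tterm
| TMul of tterm & tterm.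

Inductive tcong : tterm -> tterm -> Prop :=
| tc_refl x : tcong x x
| tc_sym x y of tcong x y : tcong y x
| tc_trans x y z of tcong x y & tcong y z : tcong x z
| tc_add x x' y y' of tcong x x' & tcong y y' : tcong (TAdd x y) (TAdd x' y')
| tc_opp x x' of tcong x x' : tcong (TOpp x) (TOpp x')
| tc_mul x x' y y' of tcong x x' & tcong y y' : tcong (TMul x y) (TMul x' y')
| tc_addA x y z : tcong (TAdd x (TAdd y z)) (TAdd (TAdd x y) z)
| tc_addC x y : tcong (TAdd x y) (TAdd y x)
| tc_add0 x : tcong (TAdd (TConst 0) x) x
| tc_addN x : tcong (TAdd (TOpp x) x) (TConst 0)
| tc_mulA x y z : tcong (TMul x (TMul y z)) (TMul (TMul x y) z)
| tc_mulC x y : tcong (TMul x y) (TMul y x)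
| tc_mul1 x : tcong (TMul (TConst 1) x) x
| tc_mulDl x y z : tcong (TMul (TAdd x y) z) (TAdd (TMul x z) (TMul y z))
| tc_constD c d : tcong (TConst (c + d)) (TAdd (TConst c) (TConst d))
| tc_constM c d : tcong (TConst (c * d)) (TMul (TConst c) (TConst d))
| tc_genD i (a b : A i) : tcong (TGen (a + b)) (TAdd (TGen a) (TGen b))
| tc_genM i (a b : A i) : tcong (TGen (a * b)) (TMul (TGen a) (TGen b))
| tc_genC i c : tcong (TGen (kalg_map (A i) c)) (TConst c).

HB.instance Definition _ := gen_eqMixin tterm.
HB.instance Definition _ := gen_choiceMixin tterm.

Definition tcongb : rel tterm := fun x y => `[< tcong x y >].

Lemma tcongb_equiv : equiv_class_of tcongb.
Proof.
split=> [x|x y|y x z]; first exact/asboolP/tc_refl.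
  by apply/asboolP/asboolP; apply: tc_sym.
by move=> /asboolP xy /asboolP yz; apply/asboolP; apply: tc_trans xy yz.
Qed.
Canonical tcongb_rel := EquivRelPack tcongb_equiv.

Definition tens := {eq_quot tcongb}.
HB.instance Definition _ := Choice.on tens.

Definition tpi (x : tterm) : tens := \pi_({eq_quot tcongb}) x.

Lemma tpiP x y : tpi x = tpi y <-> tcong x y.
Proof.
split=> [xy|xy]; first by apply/asboolP; rewrite -[`[< _ >]]/(tcongb_rel x y) -eqmodE; apply/eqP.
by apply/eqmodP; apply/asboolP.
Qed.

Lemma tpi_repr (q : tens) : tpi (repr q) = q. Proof. exact: reprK. Qed.

Lemma repr_tpi x : tcong (repr (tpi x)) x.
Proof. by apply/tpiP; rewrite tpi_repr. Qed.

Definition tens_add (x y : tens) := tpi (TAdd (repr x) (repr y)).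
Definition tens_opp (x : tens) := tpi (TOpp (repr x)).
Definition tens_mul (x y : tens) := tpi (TMul (repr x) (repr y)).

Lemma tpi_add x y : tens_add (tpi x) (tpi y) = tpi (TAdd x y).
Proof. by apply/tpiP; apply: tc_add; apply: repr_tpi. Qed.
Lemma tpi_opp x : tens_opp (tpi x) = tpi (TOpp x).
Proof. by apply/tpiP; apply: tc_opp; apply: repr_tpi. Qed.
Lemma tpi_mul x y : tens_mul (tpi x) (tpi y) = tpi (TMul x y).
Proof. by apply/tpiP; apply: tc_mul; apply: repr_tpi. Qed.

Lemma tens_addA : associative tens_add.
Proof.
move=> x y z; rewrite -[x]tpi_repr -[y]tpi_repr -[z]tpi_repr !tpi_add.
exact/tpiP/tc_addA.
Qed.
Lemma tens_addC : commutative tens_add.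
Proof. by move=> x y; exact/tpiP/tc_addC. Qed.
Lemma tens_add0 : left_id (tpi (TConst 0)) tens_add.
Proof. by move=> x; rewrite -[x]tpi_repr tpi_add; exact/tpiP/tc_add0. Qed.
Lemma tens_addN : left_inverse (tpi (TConst 0)) tens_opp tens_add.
Proof. by move=> x; rewrite -[x]tpi_repr tpi_opp tpi_add; exact/tpiP/tc_addN. Qed.
HB.instance Definition _ :=
  GRing.isZmodule.Build tens tens_addA tens_addC tens_add0 tens_addN.

Lemma tens_mulA : associative tens_mul.
Proof.
move=> x y z; rewrite -[x]tpi_repr -[y]tpi_repr -[z]tpi_repr !tpi_mul.
exact/tpiP/tc_mulA.
Qed.
Lemma tens_mulC : commutative tens_mul.
Proof. by move=> x y; exact/tpiP/tc_mulC. Qed.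
Lemma tens_mul1 : left_id (tpi (TConst 1)) tens_mul.
Proof. by move=> x; rewrite -[x]tpi_repr tpi_mul; exact/tpiP/tc_mul1. Qed.
Lemma tens_mulDl : left_distributive tens_mul tens_add.
Proof.
move=> x y z; rewrite -[x]tpi_repr -[y]tpi_repr -[z]tpi_repr.
by rewrite !(tpi_add, tpi_mul); exact/tpiP/tc_mulDl.
Qed.
HB.instance Definition _ := GRing.Zmodule_isComPzRing.Build tens
  tens_mulA tens_mulC tens_mul1 tens_mulDl.

Lemma tpiD x y : tpi (TAdd x y) = tpi x + tpi y. Proof. by rewrite -tpi_add. Qed.
Lemma tpiN x : tpi (TOpp x) = - tpi x. Proof. by rewrite -tpi_opp. Qed.
Lemma tpiM x y : tpi (TMul x y) = tpi x * tpi y. Proof. by rewrite -tpi_mul. Qed.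

Definition tens_const (c : k) : tens := tpi (TConst c).

Lemma tens_const_zmod_morphism : zmod_morphism tens_const.
Proof.
move=> c d; apply/eqP; rewrite eq_sym subr_eq -tpiD; apply/eqP.
by rewrite -[in LHS](subrK d c); apply/tpiP/tc_constD.
Qed.
Lemma tens_const_monoid_morphism : monoid_morphism tens_const.
Proof. by split=> // c d; rewrite /tens_const -tpiM; exact/tpiP/tc_constM. Qed.
HB.instance Definition _ :=
  GRing.isZmodMorphism.Build k tens tens_const tens_const_zmod_morphism.
HB.instance Definition _ :=
  GRing.isMonoidMorphism.Build k tens tens_const tens_const_monoid_morphism.

Definition tensor : kalg k := @KAlg k tens tens_const.

Definition tin_fun i (a : A i) : tens := tpi (TGen a).

Lemma tin_zmod_morphism i : zmod_morphism (@tin_fun i).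
Proof.
move=> a b; apply/eqP; rewrite eq_sym subr_eq -tpiD; apply/eqP.
by rewrite -[in LHS](subrK b a); apply/tpiP/tc_genD.
Qed.
Lemma tin_monoid_morphism i : monoid_morphism (@tin_fun i).
Proof.
split=> [|a b]; last by rewrite /tin_fun -tpiM; exact/tpiP/tc_genM.
by rewrite -(rmorph1 (kalg_map (A i))); exact/tpiP/tc_genC.
Qed.
HB.instance Definition _ i :=
  GRing.isZmodMorphism.Build (A i) tens (@tin_fun i) (@tin_zmod_morphism i).
HB.instance Definition _ i :=
  GRing.isMonoidMorphism.Build (A i) tens (@tin_fun i) (@tin_monoid_morphism i).

Program Definition tin i : khom (A i) tensor := @KHom k (A i) tensor (@tin_fun i) _.
Next Obligation. by move=> i c; exact/tpiP/tc_genC. Qed.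

Lemma tens_ind (P : tensor -> Prop) :
    (forall c, P (kalg_map tensor c)) -> (forall i a, P (tin i a)) ->
    (forall x y, P x -> P y -> P (x + y)) -> (forall x, P x -> P (- x)) ->
    (forall x y, P x -> P y -> P (x * y)) ->
  forall x, P x.
Proof.
move=> Pc Pg PD PN PM x; rewrite -[x]tpi_repr.
elim: (repr x) => [c|i a|y Py z Pz|y Py|y Py z Pz]; first exact: Pc.
- exact: Pg.
- by rewrite tpiD; apply: PD.
- by rewrite tpiN; apply: PN.
- by rewrite tpiM; apply: PM.
Qed.

Lemma tens_ext (C : pzRingType) (f g : {rmorphism tensor -> C}) :
    (forall c, f (kalg_map tensor c) = g (kalg_map tensor c)) ->
    (forall i a, f (tin i a) = g (tin i a)) ->
  f =1 g.
Proof.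
move=> fgc fgg; apply: tens_ind => // [x y|x|x y].
- by rewrite !rmorphD => -> ->.
- by rewrite !rmorphN => ->.
- by rewrite !rmorphM => -> ->.
Qed.

Section Lift.
Variables (B : kalg k) (f : forall i, khom (A i) B).

Fixpoint teval (t : tterm) : B :=
  match t with
  | TConst c => kalg_map B c
  | TGen i a => f i a
  | TAdd x y => teval x + teval y
  | TOpp x => - teval x
  | TMul x y => teval x * teval y
  end.

Lemma teval_cong x y : tcong x y -> teval x = teval y.
Proof.
elim=> //= *; rewrite ?(rmorphD, rmorphM, rmorph0, rmorph1, khom_map) //; try congruence.
- by rewrite addrA.
- by rewrite addrC.
- by rewrite add0r.
- by rewrite addNr.
- by rewrite mulrA.
- by rewrite mulrC.
- by rewrite mul1r.
- by rewrite mulrDl.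
Qed.

Definition tens_lift_fun (x : tens) : B := teval (repr x).

Lemma tens_lift_tpi t : tens_lift_fun (tpi t) = teval t.
Proof. by apply: teval_cong; apply: repr_tpi. Qed.

Lemma tens_lift_zmod_morphism : zmod_morphism tens_lift_fun.
Proof.
move=> x y; rewrite -[x]tpi_repr -[y]tpi_repr -tpiN -tpiD.
by rewrite !tens_lift_tpi.
Qed.
Lemma tens_lift_monoid_morphism : monoid_morphism tens_lift_fun.
Proof.
split=> [|x y]; first exact: etrans (tens_lift_tpi (TConst 1)) (rmorph1 _).
by rewrite -[x]tpi_repr -[y]tpi_repr -tpiM !tens_lift_tpi.
Qed.
HB.instance Definition _ :=
  GRing.isZmodMorphism.Build tens B tens_lift_fun tens_lift_zmod_morphism.
HB.instance Definition _ :=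
  GRing.isMonoidMorphism.Build tens B tens_lift_fun tens_lift_monoid_morphism.

Program Definition tens_lift : khom tensor B := @KHom k tensor B tens_lift_fun _.
Next Obligation. by move=> c; apply: (tens_lift_tpi (TConst c)). Qed.

Lemma tens_lift_in i a : tens_lift (tin i a) = f i a.
Proof. exact: tens_lift_tpi. Qed.

End Lift.
End Tensor.

Section BaseChange.
Variables (k : fieldType) (tau : {rmorphism k -> k}) (A : kalg k).

Definition bc_factors (b : bool) : kalg k := if b then A else @KAlg k k tau.

(* [A (x)_k k], formed via [tau], as a k-algebra via the right factor *)
Definition base_change : kalg k :=
  @KAlg k (tensor bc_factors) (@tin k bool bc_factors false).

Definition bc_left (a : A) : base_change := @tin k bool bc_factors true a.

HB.instance Definition _ := GRing.isZmodMorphism.Build A base_change bc_left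
  (rmorphB (@tin k bool bc_factors true)).
HB.instance Definition _ := GRing.isMonoidMorphism.Build A base_change bc_left
  (rmorph1 (@tin k bool bc_factors true), rmorphM (@tin k bool bc_factors true)).

Lemma bc_left_map c : bc_left (kalg_map A c) = kalg_map base_change (tau c).
Proof.
have L := khom_map (@tin k bool bc_factors true) c.
have R := khom_map (@tin k bool bc_factors false) c.
exact: etrans L (esym R).
Qed.

Lemma bc_ext (C : pzRingType) (f g : {rmorphism base_change -> C}) :
    (forall c, f (kalg_map base_change c) = g (kalg_map base_change c)) ->
    (forall a, f (bc_left a) = g (bc_left a)) ->
  f =1 g.
Proof.
move=> fgc fga; apply: tens_ext => [c|[]] //.
by rewrite -(khom_map (@tin k bool bc_factors false)); apply: fgc.
Qed.

Section Lift.
Variables (B : kalg k) (f : khom A (krestrict tau B)).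

Program Definition bc_lift_right : khom (bc_factors false) (krestrict tau B) :=
  @KHom k (bc_factors false) (krestrict tau B) (kalg_map B) _.

Definition bc_lift_fam (b : bool) : khom (bc_factors b) (krestrict tau B) :=
  if b return khom (bc_factors b) (krestrict tau B) then f else bc_lift_right.

Program Definition bc_lift : khom base_change B :=
  @KHom k base_change B (tens_lift bc_lift_fam) _.
Next Obligation. by move=> c; apply: (tens_lift_in bc_lift_fam (i := false)). Qed.

Lemma bc_lift_left a : bc_lift (bc_left a) = f a.
Proof. exact: (tens_lift_in bc_lift_fam (i := true)). Qed.

End Lift.
End BaseChange.

Record sigma_ops (n : nat) (R : comPzRingType) := SigmaOps {
  sigma_op :> 'I_n -> {rmorphism R -> R};
  sigma_opC : forall i j x, sigma_op i (sigma_op j x) = sigma_op j (sigma_op i x) }.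

(* [tau : mon n] encodes the monomial prod_j sigma_j ^ (tau j) of T_sigma. *)
Definition mon (n : nat) := {ffun 'I_n -> nat}.
Definition mon1 n : mon n := [ffun=> 0%N].
Definition mon_mul_sigma n (j : 'I_n) (tau : mon n) : mon n :=
  [ffun i => (tau i + (i == j))%N].
Definition mon_ord n (tau : mon n) : nat := (\sum_(j < n) tau j)%N.

Section MonAct.
Variables (n : nat) (R : comPzRingType) (s : sigma_ops n R).

Definition mon_act (tau : mon n) : {rmorphism R -> R} :=
  foldr (fun j f => iter (tau j) (fun g : {rmorphism R -> R} => s j \o g) f)
        (idfun : {rmorphism R -> R}) (enum 'I_n).

Lemma mon_act1 x : mon_act (mon1 n) x = x.
Proof. by rewrite /mon_act; elim: (enum _) => //= j l IH; rewrite ffunE. Qed.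

Lemma mon_act_mul j tau x : mon_act (mon_mul_sigma j tau) x = s j (mon_act tau x).
Proof.
pose F (t : mon n) j f := iter (t j) (fun g : {rmorphism R -> R} => s j \o g) f.
rewrite -[mon_act _]/(foldr (F _) _ _) -[mon_act tau]/(foldr (F tau) _ _).
have iterC i m (f : {rmorphism R -> R}) y :
    iter m (fun g : {rmorphism R -> R} => s i \o g) f y = iter m (s i) (f y).
  by elim: m => //= m ->.
have sC i m y : s j (iter m (s i) y) = iter m (s i) (s j y).
  by elim: m => //= m <-; rewrite sigma_opC.
have notin l : j \notin l ->
    foldr (F (mon_mul_sigma j tau)) idfun l x = foldr (F tau) idfun l x.
  elim: l => //= i l IH; rewrite inE negb_or eq_sym => /andP[/negbTE ij jl].
  by rewrite [in LHS]/F [in RHS]/F !iterC IH // ffunE ij addn0.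
have: j \in enum 'I_n by rewrite mem_enum.
elim: (enum 'I_n) (enum_uniq 'I_n) => //= i l IH /andP[il ul].
rewrite [in LHS]/F [in RHS]/F !iterC inE ffunE [j == i]eq_sym; have [ij|ij] /= := eqVneq i j.
  by rewrite -ij in notin *; rewrite notin ?addn1 //= ij.
by move=> jl; rewrite addn0 IH // sC.
Qed.

Lemma mon_act_rec (h : mon n -> R) :
    (forall j tau, h (mon_mul_sigma j tau) = s j (h tau)) ->
  forall tau, h tau = mon_act tau (h (mon1 n)).
Proof.
move=> hS tau; elim: {tau}(mon_ord tau) {-2}tau (erefl (mon_ord tau)) => [|m IH] tau.
  move=> /eqP; rewrite sum_nat_eq0 => /forallP t0.
  have -> : tau = mon1 n by apply/ffunP=> i; rewrite ffunE; apply/eqP/t0.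
  by rewrite mon_act1.
move=> tm; have [/forallP t0|] := boolP [forall j, tau j == 0%N].
  by move: tm; rewrite /mon_ord big1 // => i _; apply/eqP/t0.
rewrite negb_forall => /existsP[j tj].
pose tau' : mon n := [ffun i => (tau i - (i == j))%N].
have et : tau = mon_mul_sigma j tau'.
  apply/ffunP=> i; rewrite !ffunE subnK //.
  by have [->|] := eqVneq; rewrite ?lt0n.
have tm' : mon_ord tau' = m.
  apply: succn_inj; rewrite -tm [in RHS]et /mon_ord.
  under [in RHS]eq_bigr do rewrite ffunE.
  rewrite big_split /= [X in (_ + X)%N](bigD1 j) //= eqxx.
  by rewrite [X in (_ + (_ + X))%N]big1 ?addn0 ?addn1 // => i /negbTE->.
by rewrite et hS mon_act_mul -IH.
Qed.

End MonAct.

Section SigmaAlgebras.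
Variables (n : nat) (k : fieldType) (sigma : sigma_ops n k).

Record sigma_alg := SigmaAlg {
  sa_alg :> kalg k;
  sa_op : sigma_ops n sa_alg;
  sa_map : forall j c, sa_op j (kalg_map sa_alg c) = kalg_map sa_alg (sigma j c) }.

Record sigma_hom (R S : sigma_alg) := SigmaHom {
  sigma_hom_fun :> khom R S;
  sigma_hom_op : forall j x, sigma_hom_fun (sa_op R j x) = sa_op S j (sigma_hom_fun x) }.

Lemma sigma_hom_eq (R S : sigma_alg) (f g : sigma_hom R S) : f =1 g -> f = g.
Proof.
case: f g => [f fP] [g gP] /= /khom_eq efg.
by subst g; rewrite (Prop_irrelevance fP gP).
Qed.

Program Definition sigma_hom_id (R : sigma_alg) : sigma_hom R R :=
  @SigmaHom R R (khom_id R) _.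

Program Definition sigma_hom_comp (R S T : sigma_alg) (g : sigma_hom S T)
  (f : sigma_hom R S) : sigma_hom R T := @SigmaHom R T (khom_comp g f) _.
Next Obligation. by move=> R S T g f j x; rewrite /= !sigma_hom_op. Qed.

Lemma sa_mon_map (R : sigma_alg) tau c :
  mon_act (sa_op R) tau (kalg_map R c) = kalg_map R (mon_act sigma tau c).
Proof.
have H := @mon_act_rec n R (sa_op R) (fun t => kalg_map R (mon_act sigma t c)).
by rewrite H ?mon_act1 // => j t; rewrite mon_act_mul sa_map.
Qed.

Lemma sigma_hom_mon (R S : sigma_alg) (f : sigma_hom R S) tau x :
  f (mon_act (sa_op R) tau x) = mon_act (sa_op S) tau (f x).
Proof.
have H := @mon_act_rec n S (sa_op S) (fun t => f (mon_act (sa_op R) t x)).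
by rewrite H ?mon_act1 // => j t; rewrite mon_act_mul sigma_hom_op.
Qed.

Definition finitely_sigma_generated (R : sigma_alg) : Prop :=
  exists F : seq R, forall a,
    in_subalg (fun x => exists tau, exists2 f, f \in F & x = mon_act (sa_op R) tau f) a.

End SigmaAlgebras.

(* A functor from k-algebras to groups together with a representation of it by
   a finitely generated k-algebra: [ag_univ] is the universal point and [ag_pt]
   turns a point into the corresponding morphism. *)
Record alg_group (k : fieldType) := AlgGroup {
  ag_fun : kalg k -> groupType;
  ag_map : forall R S, khom R S -> {multiplicative ag_fun R -> ag_fun S};
  ag_map_id : forall R g, ag_map (khom_id R) g = g;
  ag_map_comp : forall R S T (f : khom S T) (h : khom R S) g,
    ag_map (khom_comp f h) g = ag_map f (ag_map h g);
  ag_coord : kalg k;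
  ag_coord_fg : finitely_generated ag_coord;
  ag_univ : ag_fun ag_coord;
  ag_pt : forall R, ag_fun R -> khom ag_coord R;
  ag_ptK : forall R (g : ag_fun R), ag_map (ag_pt g) ag_univ = g;
  ag_mapK : forall R (h : khom ag_coord R), ag_pt (ag_map h ag_univ) = h }.

Record sigma_group (n : nat) (k : fieldType) (sigma : sigma_ops n k) := SigmaGroup {
  sg_fun : sigma_alg sigma -> groupType;
  sg_map : forall R S, sigma_hom R S -> {multiplicative sg_fun R -> sg_fun S};
  sg_map_id : forall R g, sg_map (sigma_hom_id R) g = g;
  sg_map_comp : forall R S T (f : sigma_hom S T) (h : sigma_hom R S) g,
    sg_map (sigma_hom_comp f h) g = sg_map f (sg_map h g);
  sg_coord : sigma_alg sigma;
  sg_coord_fg : finitely_sigma_generated sg_coord;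
  sg_univ : sg_fun sg_coord;
  sg_pt : forall R, sg_fun R -> sigma_hom sg_coord R;
  sg_ptK : forall R (g : sg_fun R), sg_map (sg_pt g) sg_univ = g;
  sg_mapK : forall R (h : sigma_hom sg_coord R), sg_pt (sg_map h sg_univ) = h }.

Section SigmaGroupMorphisms.
Variables (n : nat) (k : fieldType) (sigma : sigma_ops n k).

Record sigma_group_hom (G H : sigma_group sigma) := SigmaGroupHom {
  sgh_fun :> forall R, {multiplicative sg_fun G R -> sg_fun H R};
  sgh_nat : forall R S (f : sigma_hom R S) g,
    sgh_fun S (sg_map G f g) = sg_map H f (sgh_fun R g) }.

Variables (G H : sigma_group sigma) (e : sigma_group_hom G H).

Definition sgh_dual : sigma_hom (sg_coord H) (sg_coord G) :=
  sg_pt (e (sg_coord G) (sg_univ G)).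

Lemma sg_pt_map R (g : sg_fun G R) :
  sg_pt (e R g) = sigma_hom_comp (sg_pt g) sgh_dual.
Proof.
by rewrite -[RHS]sg_mapK sg_map_comp sg_ptK -sgh_nat sg_ptK.
Qed.

(* the R-points of the sigma-closed subgroup of H defined by the kernel of the
   dual map *)
Definition in_image_subgroup R (h : sg_fun H R) : Prop :=
  forall x, x \in ker sgh_dual -> sg_pt h x = 0.

(* [e] induces an isomorphism from G onto that subgroup; equivalently the dual
   map is surjective, see [sigma_closed_embeddingP] *)
Definition sigma_closed_embedding : Prop :=
  forall R, injective (e R) /\
    forall h, in_image_subgroup h -> exists g, e R g = h.

End SigmaGroupMorphisms.

Section SigmaQuotient.
Variables (n : nat) (k : fieldType) (sigma : sigma_ops n k) (R : sigma_alg sigma).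
Variables (I : ideal R) (sI : forall j x, x \in I -> sa_op R j x \in I).

Definition kquot : kalg k := @KAlg k (ideal_quot I) (@ideal_pi R I \o kalg_map R).

Definition sigma_quot_fun j (q : ideal_quot I) : ideal_quot I :=
  ideal_pi I (sa_op R j (repr q)).

Lemma sigma_quot_pi j x : sigma_quot_fun j (ideal_pi I x) = ideal_pi I (sa_op R j x).
Proof.
apply/ideal_piP; rewrite -rmorphB; apply: sI.
by apply/ideal_piP; rewrite ideal_pi_repr.
Qed.

Lemma sigma_quot_zmod_morphism j : zmod_morphism (sigma_quot_fun j).
Proof.
move=> x y; rewrite -[x]ideal_pi_repr -[y]ideal_pi_repr -rmorphB !sigma_quot_pi.
by rewrite !rmorphB.
Qed.
Lemma sigma_quot_monoid_morphism j : monoid_morphism (sigma_quot_fun j).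
Proof.
split=> [|x y]; first by rewrite -[1]/(ideal_pi I 1) sigma_quot_pi rmorph1.
rewrite -[x]ideal_pi_repr -[y]ideal_pi_repr -rmorphM !sigma_quot_pi.
by rewrite !rmorphM.
Qed.
HB.instance Definition _ j := GRing.isZmodMorphism.Build _ _
  (sigma_quot_fun j) (sigma_quot_zmod_morphism j).
HB.instance Definition _ j := GRing.isMonoidMorphism.Build _ _
  (sigma_quot_fun j) (sigma_quot_monoid_morphism j).

Program Definition sigma_quot_ops : sigma_ops n (ideal_quot I) :=
  @SigmaOps n (ideal_quot I) (fun j => sigma_quot_fun j) _.
Next Obligation.
move=> i j x; rewrite -[x]ideal_pi_repr /= !sigma_quot_pi.
by rewrite sigma_opC.
Qed.

Program Definition sigma_quot : sigma_alg sigma :=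
  @SigmaAlg n k sigma kquot sigma_quot_ops _.
Next Obligation. by move=> j c; rewrite /= sigma_quot_pi sa_map. Qed.

Program Definition sigma_quot_pi_hom : sigma_hom R sigma_quot :=
  @SigmaHom n k sigma R sigma_quot (@KHom k R kquot (@ideal_pi R I) _) _.
Next Obligation. by move=> j x; rewrite /= sigma_quot_pi. Qed.

End SigmaQuotient.

Lemma sigma_closed_embeddingP (n : nat) (k : fieldType) (sigma : sigma_ops n k)
    (G H : sigma_group sigma) (e : sigma_group_hom G H) :
  sigma_closed_embedding e <-> (forall y, exists x, sgh_dual e x = y).
Proof.
split=> [ce|surj R].
  have sI j x : x \in ker (sgh_dual e) -> sa_op (sg_coord H) j x \in ker (sgh_dual e).
    by rewrite !inE sigma_hom_op => /eqP->; rewrite rmorph0.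
  pose Q := sigma_quot sI; pose p : sigma_hom _ Q := sigma_quot_pi_hom sI.
  have [g eg] : exists g, e Q g = sg_map H p (sg_univ H).
    apply: (ce Q).2 => x Ix; rewrite sg_mapK /=.
    rewrite -(rmorph0 (@ideal_pi _ (ker (sgh_dual e)))).
    by apply/ideal_piP; rewrite subr0.
  pose i0 (q : Q) : sg_coord G := sgh_dual e (repr (q : ideal_quot _)).
  have i0p x : i0 (p x) = sgh_dual e x.
    apply/eqP; rewrite -subr_eq0 -rmorphB.
    have /ideal_piP: ideal_pi (ker (sgh_dual e)) (repr (p x : ideal_quot _)) =
                     ideal_pi (ker (sgh_dual e)) x by exact: ideal_pi_repr.
    by rewrite inE.
  have pr (q : Q) : exists x, q = p x by exists (repr (q : ideal_quot _)); rewrite [RHS]ideal_pi_repr.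
  have i0A : zmod_morphism i0.
    by move=> q r; have [[x ->] [y ->]] := (pr q, pr r); rewrite -rmorphB !i0p rmorphB.
  have i0M : monoid_morphism i0.
    split=> [|q r]; first by rewrite -(rmorph1 p) i0p rmorph1.
    by have [[x ->] [y ->]] := (pr q, pr r); rewrite -rmorphM !i0p rmorphM.
  pose ma := GRing.isZmodMorphism.Build _ _ i0 i0A.
  pose mm := GRing.isMonoidMorphism.Build _ _ i0 i0M.
  pose i1 : {rmorphism Q -> sg_coord G} := HB.pack i0 ma mm.
  have i1c c : i1 (kalg_map Q c) = kalg_map (sg_coord G) c.
    by rewrite -(khom_map p) /= i0p khom_map.
  have i1s j q : KHom i1c (sa_op Q j q) = sa_op (sg_coord G) j (KHom i1c q).
    by have [x ->] := pr q; rewrite -sigma_hom_op /= !i0p sigma_hom_op.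
  pose i : sigma_hom Q (sg_coord G) := SigmaHom i1s.
  have fix_univ : sg_map G i g = sg_univ G.
    apply: (ce _).1; rewrite sgh_nat eg -sg_map_comp -[RHS]sg_ptK.
    congr (sg_map H _ _); apply: sigma_hom_eq => x /=; exact: i0p.
  have ig : sigma_hom_comp i (sg_pt g) = sigma_hom_id (sg_coord G).
    rewrite -[LHS]sg_mapK -[RHS]sg_mapK sg_map_comp sg_ptK fix_univ.
    by rewrite sg_map_id.
  move=> y; exists (repr (sg_pt g y : ideal_quot _)).
  exact: (congr1 (fun h : sigma_hom _ _ => h y) ig).
split=> [g g' egg'|h Ih].
  rewrite -[g]sg_ptK -[g']sg_ptK; congr (sg_map G _ _).
  apply: sigma_hom_eq => y; have [x <-] := surj y.
  have := sg_pt_map e g; rewrite egg' sg_pt_map => E.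
  by have := congr1 (fun f : sigma_hom _ _ => f x) E.
pose s y := sval (cid (surj y)).
have sK y : sgh_dual e (s y) = y by rewrite /s; case: cid.
have hs x : sg_pt h (s (sgh_dual e x)) = sg_pt h x.
  apply/eqP; rewrite -subr_eq0 -rmorphB; apply/eqP/Ih.
  by rewrite inE rmorphB sK subrr.
pose f0 y := sg_pt h (s y).
have f0A : zmod_morphism f0.
  by move=> y z; rewrite /f0 -[y in LHS]sK -[z in LHS]sK -rmorphB hs rmorphB.
have f0M : monoid_morphism f0.
  split=> [|y z]; first by rewrite /f0 -(rmorph1 (sgh_dual e)) hs rmorph1.
  by rewrite /f0 -[y in LHS]sK -[z in LHS]sK -rmorphM hs rmorphM.
pose ma := GRing.isZmodMorphism.Build _ _ f0 f0A.
pose mm := GRing.isMonoidMorphism.Build _ _ f0 f0M.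
pose f1 : {rmorphism sg_coord G -> R} := HB.pack f0 ma mm.
have f1c c : f1 (kalg_map _ c) = kalg_map R c.
  by rewrite -(khom_map (sgh_dual e)) [LHS]hs khom_map.
have f1s j y : KHom f1c (sa_op _ j y) = sa_op R j (KHom f1c y).
  by rewrite -[y in LHS]sK -sigma_hom_op [LHS]hs sigma_hom_op.
exists (sg_map G (SigmaHom f1s) (sg_univ G)).
rewrite -[LHS]sg_ptK -[RHS]sg_ptK; congr (sg_map H _ _).
by rewrite sg_pt_map sg_mapK; apply: sigma_hom_eq => x; apply: hs.
Qed.

Section Weil.
Variables (n : nat) (k : fieldType) (sigma : sigma_ops n k).

Section CoordinateRings.
Variable A : kalg k.

(* For A = k[GG], [factor tau] is the coordinate ring of the base change of GG
   along tau, [coord_all] is k{GG} and [coord_le i] is k[GG[i]]. *)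
Definition factor (tau : mon n) : kalg k := base_change (mon_act sigma tau) A.

Definition coord_all : kalg k := tensor factor.

Definition coord_le (i : nat) : kalg k :=
  tensor (fun t : {t : mon n | (mon_ord t <= i)%N} => factor (val t)).

Definition coord_le_in (i : nat) : khom (coord_le i) coord_all :=
  tens_lift (fun t : {t : mon n | (mon_ord t <= i)%N} => tin factor (val t)).

(* r (x) 1 in the tau-factor *)
Definition kgen (tau : mon n) (r : A) : coord_all := tin factor tau (bc_left _ r).

HB.instance Definition _ tau :=
  GRing.RMorphism.copy (kgen tau) (tin factor tau \o @bc_left _ (mon_act sigma tau) A).

Lemma kgen_map tau c : kgen tau (kalg_map A c) = kalg_map coord_all (mon_act sigma tau c).
Proof. by rewrite /kgen bc_left_map khom_map. Qed.

Lemma coord_all_ext (C : pzRingType) (f g : {rmorphism coord_all -> C}) :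
    (forall c, f (kalg_map coord_all c) = g (kalg_map coord_all c)) ->
    (forall tau r, f (kgen tau r) = g (kgen tau r)) ->
  f =1 g.
Proof.
move=> fgc fgg; apply: tens_ext => // tau a.
have := @bc_ext _ _ _ C (f \o tin factor tau) (g \o tin factor tau).
apply=> [c|r]; last exact: fgg.
by rewrite /= (khom_map (tin factor tau)).
Qed.

Program Definition coord_all_sigma_gen j tau :
    khom A (krestrict (mon_act sigma tau) (krestrict (sigma j) coord_all)) :=
  @KHom k A (krestrict (mon_act sigma tau) (krestrict (sigma j) coord_all))
    (kgen (mon_mul_sigma j tau)) _.
Next Obligation. 
move=> j tau c; apply: etrans (kgen_map _ c) _; congr (kalg_map coord_all _).
exact: mon_act_mul.
Qed.

Definition coord_all_sigma j : khom coord_all (krestrict (sigma j) coord_all) :=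
  tens_lift (fun tau => bc_lift (coord_all_sigma_gen j tau)).

Lemma coord_all_sigma_kgen j tau r :
  coord_all_sigma j (kgen tau r) = kgen (mon_mul_sigma j tau) r.
Proof. by rewrite [LHS]tens_lift_in bc_lift_left. Qed.

Lemma coord_all_sigma_map j c : coord_all_sigma j (kalg_map coord_all c) = kalg_map coord_all (sigma j c).
Proof. exact: khom_map. Qed.

(* sigma_j maps r (x) c in the tau-factor to r (x) sigma_j(c) in the
   (sigma_j tau)-factor *)
Lemma coord_all_sigmaE j tau (r : A) (c : k) :
  coord_all_sigma j (tin factor tau (bc_left _ r * kalg_map _ c)) =
  tin factor (mon_mul_sigma j tau) (bc_left _ r * kalg_map _ (sigma j c)).
Proof.
rewrite !rmorphM; congr (_ * _); first exact: coord_all_sigma_kgen.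
by rewrite !khom_map.
Qed.

Program Definition coord_all_ops : sigma_ops n coord_all :=
  @SigmaOps n coord_all (fun j => coord_all_sigma j) _.
Next Obligation.
move=> i j x.
have := @coord_all_ext coord_all (coord_all_sigma i \o coord_all_sigma j) (coord_all_sigma j \o coord_all_sigma i).
apply=> [c|tau r] /=; first by rewrite !coord_all_sigma_map sigma_opC.
rewrite !coord_all_sigma_kgen; congr (kgen _ _).
by apply/ffunP=> l; rewrite !ffunE addnAC.
Qed.

Definition coord_all_alg : sigma_alg sigma :=
  @SigmaAlg n k sigma coord_all coord_all_ops coord_all_sigma_map.

Lemma kgen_mon tau r : kgen tau r = mon_act (sa_op coord_all_alg) tau (kgen (mon1 n) r).
Proof.
have H := @mon_act_rec n coord_all (sa_op coord_all_alg) (fun t => kgen t r).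
by rewrite H // => j t; rewrite [RHS]coord_all_sigma_kgen.
Qed.

Program Definition coord_all_univ : khom A coord_all_alg :=
  @KHom k A coord_all_alg (kgen (mon1 n)) _.
Next Obligation. by move=> c; rewrite /= kgen_map mon_act1. Qed.

Section Lift.
Variables (R : sigma_alg sigma) (f : khom A R).

Program Definition coord_all_lift_gen tau : khom A (krestrict (mon_act sigma tau) R) :=
  @KHom k A (krestrict (mon_act sigma tau) R) (mon_act (sa_op R) tau \o f) _.
Next Obligation. by move=> tau c; rewrite /= khom_map sa_mon_map. Qed.

Definition coord_all_lift0 : khom coord_all R :=
  tens_lift (fun tau => bc_lift (coord_all_lift_gen tau)).

Lemma coord_all_lift0_kgen tau r : coord_all_lift0 (kgen tau r) = mon_act (sa_op R) tau (f r).
Proof. by rewrite [LHS]tens_lift_in bc_lift_left. Qed.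

Program Definition coord_all_lift : sigma_hom coord_all_alg R :=
  @SigmaHom n k sigma coord_all_alg R coord_all_lift0 _.
Next Obligation.
move=> j x.
have := @coord_all_ext R (coord_all_lift0 \o coord_all_sigma j) (sa_op R j \o coord_all_lift0).
apply=> [c|tau r] /=; last first.
  by rewrite coord_all_sigma_kgen !coord_all_lift0_kgen mon_act_mul.
by rewrite coord_all_sigma_map (khom_map coord_all_lift0) (khom_map coord_all_lift0) sa_map.
Qed.

Lemma coord_all_lift_univ : khom_comp coord_all_lift coord_all_univ = f.
Proof. by apply: khom_eq => r /=; rewrite coord_all_lift0_kgen mon_act1. Qed.

End Lift.

Lemma coord_all_liftK (R : sigma_alg sigma) (h : sigma_hom coord_all_alg R) :
  coord_all_lift (khom_comp h coord_all_univ) = h.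
Proof.
apply: sigma_hom_eq; apply: coord_all_ext => [c|tau r]; first by rewrite !khom_map.
rewrite [LHS]coord_all_lift0_kgen kgen_mon; apply: esym.
exact: (sigma_hom_mon h tau (kgen (mon1 n) r)).
Qed.

Lemma coord_all_fg : finitely_generated A -> finitely_sigma_generated coord_all_alg.
Proof.
move=> [F FP]; exists [seq coord_all_univ r | r <- F].
set X := fun x : coord_all_alg => _.
have Xgen tau r : @in_subalg k coord_all_alg X (kgen tau r).
  elim: (FP r) => [x Fx|c|x y _ Hx _ Hy|x y _ Hx _ Hy].
  - apply: in_subalg_gen; exists tau; exists (coord_all_univ x); first exact: map_f.
    exact: kgen_mon.
  - by rewrite kgen_map; apply: (@in_subalg_const k coord_all_alg).
  - by rewrite rmorphD; apply: (@in_subalg_add k coord_all_alg).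
  - by rewrite rmorphM; apply: (@in_subalg_mul k coord_all_alg).
have XN x : @in_subalg k coord_all_alg X x -> @in_subalg k coord_all_alg X (- x).
  move=> Xx; rewrite -mulN1r -(rmorphN1 (kalg_map coord_all_alg)).
  by apply: in_subalg_mul => //; apply: in_subalg_const.
move=> a; apply: (@tens_ind k _ factor (@in_subalg k coord_all_alg X)) => //.
- exact: (@in_subalg_const k coord_all_alg).
- move=> tau b.
  pose P (b : factor tau) := @in_subalg k coord_all_alg X (tin factor tau b).
  apply: (@tens_ind k _ (bc_factors (mon_act sigma tau) A) P) => {b}; rewrite /P.
  + move=> c; rewrite -(khom_map (tin (bc_factors _ A) false)).
    rewrite -[tin (bc_factors _ _) false _]/(kalg_map (factor tau) _) khom_map.
    exact: (@in_subalg_const k coord_all_alg).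
  + case=> b; first exact: Xgen.
    rewrite -[tin (bc_factors _ _) false _]/(kalg_map (factor tau) _) khom_map.
    exact: (@in_subalg_const k coord_all_alg).
  + by move=> x y Xx Xy; rewrite rmorphD; apply: (@in_subalg_add k coord_all_alg).
  + by move=> x Xx; rewrite rmorphN; apply: XN.
  + by move=> x y Xx Xy; rewrite rmorphM; apply: (@in_subalg_mul k coord_all_alg).
- exact: (@in_subalg_add k coord_all_alg).
- exact: (@in_subalg_mul k coord_all_alg).
Qed.

End CoordinateRings.

Variable GG : alg_group k.

(* R |-> GG(R), represented by k{GG} *)
Program Definition sigma_of_alg_group : sigma_group sigma :=
  @SigmaGroup n k sigma
    (fun R => ag_fun GG R)
    (fun R S h => ag_map GG h)
    _ _
    (coord_all_alg (ag_coord GG))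
    (coord_all_fg (ag_coord_fg GG))
    (ag_map GG (coord_all_univ (ag_coord GG)) (ag_univ GG))
    (fun R g => coord_all_lift (ag_pt g))
    _ _.
Next Obligation. by move=> R g; apply: ag_map_id. Qed.
Next Obligation. by move=> R S T f h g; apply: ag_map_comp. Qed.
Next Obligation. by move=> R g /=; rewrite -ag_map_comp coord_all_lift_univ ag_ptK. Qed.
Next Obligation. by move=> R h /=; rewrite -ag_map_comp ag_mapK coord_all_liftK. Qed.

Definition counit : khom (ag_coord GG) (@KAlg k k idfun) :=
  ag_pt (1%g : ag_fun GG (@KAlg k k idfun)).

(* [coord_le_in_inj] and [coord_le_in_surj]: k{GG} is the union of its
   subrings k[GG[i]]. *)
Lemma coord_le_in_inj i : injective (coord_le_in (ag_coord GG) i).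
Proof.
set A := ag_coord GG; pose B := coord_le A i.
have cP tau c : (kalg_map B \o mon_act sigma tau \o counit) (kalg_map A c) =
    kalg_map (krestrict (mon_act sigma tau) B) c.
  by rewrite /= khom_map.
pose f0 tau : khom (factor A tau) B := bc_lift
  (@KHom k A (krestrict (mon_act sigma tau) B)
    (kalg_map B \o mon_act sigma tau \o counit) (cP tau)).
pose T := {t : mon n | (mon_ord t <= i)%N}.
pose F := fun t : T => factor A (val t).
pose f tau : khom (factor A tau) B :=
  match boolP (mon_ord tau <= i)%N with
  | AltTrue h => tin F (exist _ tau h)
  | AltFalse _ => f0 tau
  end.
apply: (can_inj (g := tens_lift f)) => x.
apply: (@tens_ext k T F B (tens_lift f \o coord_le_in A i) idfun) => [c|t a] /=.
  by rewrite (khom_map (coord_le_in A i)) (khom_map (tens_lift f)).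
rewrite -[X in tens_lift f X]/(coord_le_in A i (tin F t a)) /coord_le_in tens_lift_in.
rewrite tens_lift_in /f.
case: t a => t ht a /=; case: {-}_ / boolP => [h|]; last by rewrite ht.
by rewrite (bool_irrelevance h ht).
Qed.

Lemma coord_le_in_surj (x : coord_all (ag_coord GG)) :
  exists i, exists y, coord_le_in (ag_coord GG) i y = x.
Proof.
set A := ag_coord GG.
pose T i := {t : mon n | (mon_ord t <= i)%N}.
have up i j (y : coord_le A i) : (i <= j)%N ->
    exists z : coord_le A j, coord_le_in A j z = coord_le_in A i y.
  move=> ij; pose inj (t : T i) : T j := exist _ (val t) (leq_trans (valP t) ij).
  pose w := tens_lift (fun t : T i => tin (fun t : T j => factor A (val t)) (inj t)).
  exists (w y).
  apply: (@tens_ext k _ _ _ (coord_le_in A j \o w) (coord_le_in A i)) => [c|t a].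
    by rewrite /= (khom_map w) (khom_map (coord_le_in A j)) (khom_map (coord_le_in A i)).
  by rewrite [RHS]tens_lift_in /= [w _]tens_lift_in [LHS]tens_lift_in.
have up2 x1 x2 : (exists i, exists y, coord_le_in A i y = x1) ->
    (exists i, exists y, coord_le_in A i y = x2) ->
    exists i, exists y1, exists2 y2, coord_le_in A i y1 = x1 & coord_le_in A i y2 = x2.
  move=> [i1 [y1 <-]] [i2 [y2 <-]]; exists (maxn i1 i2).
  have [z1 e1] := up _ _ y1 (leq_maxl i1 i2).
  have [z2 e2] := up _ _ y2 (leq_maxr i1 i2).
  by exists z1; exists z2.
elim/tens_ind: x => [c|tau a|x1 x2 h1 h2|x1 [i [y <-]]|x1 x2 h1 h2].
- by exists 0%N; exists (kalg_map _ c); apply: khom_map.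
- exists (mon_ord tau).
  exists (tin (fun t : T (mon_ord tau) => factor A (val t)) (exist _ tau (leqnn _)) a).
  exact: tens_lift_in.
- have [i [y1 [y2 <- <-]]] := up2 _ _ h1 h2; exists i; exists (y1 + y2).
  exact: rmorphD.
- by exists i; exists (- y); apply: rmorphN.
- have [i [y1 [y2 <- <-]]] := up2 _ _ h1 h2; exists i; exists (y1 * y2).
  exact: rmorphM.
Qed.

End Weil.

Section ZariskiClosure.
Variables (n : nat) (k : fieldType) (sigma : sigma_ops n k).
Variables (G : sigma_group sigma) (GG : alg_group k).
Variable e : sigma_group_hom G (sigma_of_alg_group sigma GG).

Definition vanishing_ideal : ideal (coord_all sigma (ag_coord GG)) := ker (sgh_dual e).

(* the coordinate ring of G[i]; the preimage along the inclusion of k[GG[i]] in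
   k{GG} is the intersection with k[GG[i]] *)
Definition zariski_closure_coord (i : nat) : comPzRingType :=
  ideal_quot (ideal_preim (coord_le_in sigma (ag_coord GG) i) vanishing_ideal).

Definition is_dimension_polynomial (phi : {poly rat}) : Prop :=
  exists N, forall i, (N <= i)%N ->
    exists2 d, has_krull_dim (zariski_closure_coord i) d & phi.[i%:R] = d%:R.

End ZariskiClosure.

(* Main.v *)
Require Import Defs.
From HB Require Import structures.
From mathcomp Require Import all_boot all_order all_algebra.
From mathcomp Require Import ring boolp classical_sets polyrcf.

Set Implicit Arguments.
Unset Strict Implicit.
Unset Printing Implicit Defensive.

Import Order.TTheory GRing.Theory Num.Theory.
Local Open Scope ring_scope.

(** Write R for k{G} and a : k[GG] -> R for the restriction to G of the
    coordinate functions of GG.  The coordinate ring of G[i] is the subalgebra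
    V_i of R generated by the tau (a r) with ord tau <= i, and a closed embedding
    makes R the union of the V_i.  A second embedding gives a second filtration
    V'_i of the same R.  As k[GG] is finitely generated, a(k[GG]) lies in some
    V'_m, and applying tau raises the index by ord tau, so V_i <= V'_(m+i)
    ([prolongation_shift]).  Krull dimension is monotone along inclusions of
    finitely generated k-algebras ([krull_dim_mono]), hence phi(i) <= phi'(m+i)
    for large i, and symmetrically.  A translation of the variable changes
    neither the degree nor the leading coefficient, so these agree.

    Monotonicity of the dimension compares prime chains with algebraically
    independent elements, a notion that does pass to overrings.  A prime chain
    P_0 < ... < P_d yields independent elements by choosing x in P_(i+1) \ P_i
    ([indep_of_chain]).  Conversely, independent elements x_0, ..., x_(m-1) of a
    finitely generated algebra C give a chain of length m ([chain_of_indep]). An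
    ideal maximal among those that avoid the nonzero polynomials in the x_i is a
    prime P_0. Passing to polynomials in x_0, ..., x_(m-2) leaves room for a
    strictly larger prime: otherwise C/P_0 would become a field after inverting
    those polynomials, although it is finitely generated and contains the
    transcendental element x_(m-1). That this is impossible is a form of
    Zariski's lemma ([exists_generic_nondivisor]). *)

(** * Transcendental elements of finitely generated algebras *)

Definition eval_at (R D : comNzRingType) (i : {rmorphism R -> D}) (x : D) :
    {rmorphism {poly R} -> D} :=
  horner_morph (fun a => mulrC x (i a)).

Lemma eval_atE (R D : comNzRingType) (i : {rmorphism R -> D}) x p :
  eval_at i x p = (map_poly i p).[x].
Proof. by []. Qed.

Lemma eval_atC (R D : comNzRingType) (i : {rmorphism R -> D}) x a :
  eval_at i x a%:P = i a.
Proof. exact: horner_morphC. Qed.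

Lemma eval_atX (R D : comNzRingType) (i : {rmorphism R -> D}) x :
  eval_at i x 'X = x.
Proof. exact: horner_morphX. Qed.

Definition ker_trivial (R D : comPzRingType) (i : {rmorphism R -> D}) :=
  forall a, i a = 0 -> a = 0.

(** Multiplying p(y) = 0 by the power c ^ (deg p - 1) of the leading coefficient
    c turns it into a monic equation for c y. *)
Lemma integral_lead_coef (R D : comNzRingType) (i : {rmorphism R -> D}) y (p : {poly R}) :
  (1 < size p)%N -> eval_at i y p = 0 -> integralOver i (i (lead_coef p) * y).
Proof.
move=> sp py0; set c := lead_coef p; set m := (size p).-1.
have sm : size p = m.+1 by rewrite /m prednK // ltnW.
have m0 : (0 < m)%N by rewrite -ltnS -sm.
pose r : {poly R} := \poly_(j < m) (c ^+ (m.-1 - j) * p`_j).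
exists ('X^m + r).
  by rewrite monicE lead_coefDl ?lead_coefXn // size_polyXn ltnS size_poly.
rewrite rootE rmorphD /= map_polyXn hornerD hornerXn.
have -> : (map_poly i r).[i c * y] = i c ^+ m.-1 * \sum_(j < m) i p`_j * y ^+ j.
  rewrite mulr_sumr (horner_coef_wide _ (n := m)); last first.
    by apply: leq_trans (size_poly _ _) _; rewrite size_poly.
  apply: eq_bigr => j _; rewrite coef_map coef_poly ltn_ord /= rmorphM rmorphXn /=.
  have jm : (j <= m.-1)%N by rewrite -ltnS prednK.
  rewrite -[in RHS](subnK jm) exprD exprMn !mulrA; congr (_ * _).
  by rewrite -!mulrA; congr (_ * _); rewrite mulrC.
rewrite exprMn -[in i c ^+ m](prednK m0) exprSr -mulrA -mulrDr.
suff -> : i c * y ^+ m + \sum_(j < m) i p`_j * y ^+ j = 0 by rewrite mulr0.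
rewrite addrC -[RHS]py0 eval_atE (horner_coef_wide _ (n := m.+1)); last first.
  by apply: leq_trans (size_poly _ _) _; rewrite sm.
rewrite big_ord_recr /= coef_map /=; congr (_ + _).
by apply: eq_bigr => j _; rewrite coef_map.
Qed.

(** Multiply a monic equation of degree N for z by w ^ N: as w z = s, all its
    terms but s ^ N are multiples of w. *)
Lemma dvd_of_integral (T D : comNzRingType) (i : {rmorphism T -> D}) (w s : T) (z : D) :
  ker_trivial i -> integralOver i z -> i w * z = i s ->
  exists N t, s ^+ N = w * t.
Proof.
move=> ki [p mp /rootP pz0] wz; set m := (size p).-1.
have sm : size p = m.+1 by rewrite /m prednK // size_poly_gt0 monic_neq0.
exists m.
exists (- \sum_(j < m) p`_j * s ^+ j * w ^+ (m.-1 - j)).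
suff H : s ^+ m + w * \sum_(j < m) p`_j * s ^+ j * w ^+ (m.-1 - j) = 0.
  by rewrite mulrN; apply/eqP; rewrite -addr_eq0 H.
apply: ki; rewrite rmorphD rmorphM rmorphXn /= -wz rmorph_sum /=.
transitivity (i w ^+ m * (map_poly i p).[z]); last by rewrite pz0 mulr0.
rewrite (horner_coef_wide _ (n := m.+1)); last by apply: leq_trans (size_poly _ _) _; rewrite sm.
rewrite big_ord_recr /= coef_map /= -lead_coefE (monicP mp) rmorph1 mul1r mulrDr.
rewrite exprMn addrC; congr (_ + _); rewrite !mulr_sumr; apply: eq_bigr => j _.
rewrite coef_map /= !(rmorphM, rmorphXn) /= -wz exprMn.
have jm : (j <= m.-1)%N by rewrite -ltnS prednK //; case: (m) j => // -[].
have -> : i w ^+ m = i w * i w ^+ j * i w ^+ (m.-1 - j).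
  rewrite -mulrA -exprD subnKC // -exprS prednK //.
  by case: (m) j {jm} => // -[].
by move: (i w ^+ j) (i w ^+ _) (z ^+ j) => A B E; ring.
Qed.

(** Modulo w = 1 + X u the polynomial X u is -1, so if w divided a power of
    u ^ M a it would divide a power of the nonzero constant a, although it has
    positive degree. *)
Lemma not_dvd_const (R : idomainType) (u : {poly R}) (a : R) M N (t : {poly R}) :
  u != 0 -> a != 0 -> (u ^+ M * a%:P) ^+ N <> (1 + 'X * u) * t.
Proof.
move=> u0 a0 H; set w := 1 + 'X * u in H.
have sw : (1 < size w)%N.
  have sXu : (1 < size ('X * u : {poly R})%R)%N by rewrite mulrC size_mulX // ltnS size_poly_gt0.
  by rewrite /w addrC size_polyDl ?size_poly1.
(* X u = w - 1, hence its powers are those of -1 modulo w. *)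
have powE m : exists v, (w - 1) ^+ m = (-1) ^+ m + w * v.
  elim: m => [|m [v Hv]]; first by exists 0; rewrite mulr0 addr0.
  by exists ((w - 1) * v + (-1) ^+ m); rewrite exprS Hv [(-1) ^+ m.+1]exprS; ring.
have Xu : 'X * u = w - 1 by rewrite /w addrC addKr.
have [q aq] : exists q, (a ^+ N)%:P = w * q.
  have [v' E] := powE (M * N)%N; exists ((-1) ^+ (M * N) * ('X ^+ (M * N) * t - v' * (a ^+ N)%:P)).
  have S1 : (-1 : {poly R}) ^+ (M * N) * (-1) ^+ (M * N) = 1.
    by rewrite -exprMn mulrNN mulr1 expr1n.
  rewrite [RHS]mulrCA; set e := (-1) ^+ (M * N) in E S1 *.
  transitivity (e * (e * (a ^+ N)%:P)); first by rewrite mulrA S1 mul1r.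
  congr (_ * _).
  rewrite mulrBr [w * ('X ^+ _ * t)]mulrCA -H exprMn -exprM mulrA -exprMn Xu E polyC_exp.
  by ring.
have q0 : q != 0.
  by apply: contraNneq a0 => q0; move/eqP: aq; rewrite q0 mulr0 polyC_eq0 expf_eq0 => /andP[].
have w0 : w != 0 by rewrite -size_poly_gt0 ltnW.
have := congr1 (fun p : {poly R} => size p) aq.
rewrite /= size_polyC expf_neq0 // size_mul // => sq.
move: q0 sw sq; rewrite -size_poly_gt0.
by case: (size q) (size w) => [|r] [|[|m]] //; rewrite addnS.
Qed.

Lemma integral_comp (R T D : comNzRingType) (c : {rmorphism R -> T})
    (i : {rmorphism R -> D}) (j : {rmorphism T -> D}) z :
  (forall a, j (c a) = i a) -> integralOver i z -> integralOver j z.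
Proof.
move=> jc [p mp pz]; exists (map_poly c p); first exact: monic_map.
rewrite -map_poly_comp; congr (root _ z): pz; apply: eq_map_poly => a.
by rewrite /= jc.
Qed.

(** This is the choice of a transcendence basis among the generators ys, with x
    already part of it: R' is the polynomial ring over R in all the members of
    the basis but the last one, x'.  The remaining generators are algebraic over
    R'[x'], and u is a common multiple of the leading coefficients of their
    equations. *)
Lemma extend_transcendental (D : comNzRingType) (R : idomainType)
    (i : {rmorphism R -> D}) (x : D) (ys : seq D) :
  ker_trivial (eval_at i x) ->
  exists (R' : idomainType) (c : {rmorphism R -> R'}) (i' : {rmorphism R' -> D}) (x' : D),
    [/\ ker_trivial c, forall a, i' (c a) = i a, ker_trivial (eval_at i' x') &
      exists2 u : {poly R'}, u != 0 &
        {in ys, forall y, integralOver (eval_at i' x') (eval_at i' x' u * y)}].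
Proof.
move=> kx; elim: ys => [|y ys [R' [c [i' [x' [kc ic kx' [u u0 intu]]]]]]].
  by exists R, idfun, i, x; split=> //; exists 1; rewrite ?oner_neq0.
pose J : {rmorphism {poly R'} -> D} := eval_at i' x'.
(* Either y is algebraic over R'[x'], or y becomes the new last variable. *)
have [[p p0 py0]|alg] := pselect (exists2 p : {poly {poly R'}}, p != 0 & eval_at J y p = 0).
  exists R', c, i', x'; split=> //; exists (u * lead_coef p).
    by rewrite mulf_neq0 ?lead_coef_eq0.
  move=> z; rewrite inE rmorphM => /predU1P[->|/intu intz].
    rewrite -mulrA; apply: integral_mul; first exact: integral_id.
    apply: integral_lead_coef (py0); rewrite ltnNge; apply: contraNN p0 => /size1_polyC pc.
    by move: py0; rewrite pc eval_atC => /kx' ->.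
  rewrite mulrAC mulrC; apply: integral_mul => //; exact: integral_id.
exists {poly R'}, (polyC \o c), J, y; split=> [a|a|p py0|].
- by move=> /polyC_inj/kc.
- by rewrite /= /J eval_atC.
- by apply/eqP; apply: contrapT => p0; apply: alg; exists p => //; apply/negP.
exists u%:P; first by rewrite polyC_eq0.
move=> z; rewrite inE eval_atC => /predU1P[->|/intu intz].
  have -> : J u * y = eval_at J y (u%:P * 'X) by rewrite rmorphM /= eval_atC eval_atX.
  exact: integral_id.
by apply: (@integral_comp _ _ _ polyC J) => // a; rewrite eval_atC.
Qed.

(** A common denominator u of the generators gives one for every element of the
    algebra, up to taking powers of u. *)
Lemma integral_subalg (k : fieldType) (T D : comNzRingType) (h : {rmorphism k -> D})
    (c : {rmorphism k -> T}) (j : {rmorphism T -> D}) (u : T) (ys : seq D) z :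
  (forall a, j (c a) = h a) ->
  {in ys, forall y, integralOver j (j u * y)} ->
  @in_subalg k (KAlg h) (fun y => y \in ys) z ->
  exists M, integralOver j (j u ^+ M * z).
Proof.
move=> jc inty; elim=> {z} [y /inty yi|a|y z _ [M My] _ [N Nz]|y z _ [M My] _ [N Nz]].
- by exists 1.
- by exists 0; rewrite expr0 mul1r /= -jc; apply: integral_id.
- exists (M + N)%N; rewrite mulrDr; apply: integral_add.
    rewrite exprD mulrAC mulrC -rmorphXn.
    by apply: integral_mul => //; apply: integral_id.
  rewrite exprD -mulrA -[in j u ^+ M]rmorphXn.
  by apply: integral_mul => //; apply: integral_id.
- exists (M + N)%N; rewrite exprD mulrACA; exact: integral_mul.
Qed.

(** Zariski's lemma in contrapositive form: D is not a field after inverting the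
    nonzero elements of R, because x is transcendental over R.  Take R', x' and u
    as in [extend_transcendental]; the element w is the value of 1 + X u at x',
    prime to the only denominators that occur. *)
Lemma exists_generic_nondivisor (k : fieldType) (D : comNzRingType) (h : {rmorphism k -> D})
    (R : idomainType) (c : {rmorphism k -> R}) (i : {rmorphism R -> D}) (x : D) :
  finitely_generated (KAlg h) ->
  (forall b, i (c b) = h b) -> ker_trivial (eval_at i x) ->
  exists2 w : D, w != 0 & forall z a, w * z = i a -> a = 0.
Proof.
move=> [ys ysP] ich kx.
have [R' [d [j [x' [kd jd kx' [u u0 intu]]]]]] := extend_transcendental ys kx.
pose J : {rmorphism {poly R'} -> D} := eval_at j x'.
exists (J (1 + 'X * u)).
  apply/eqP => /kx' /(congr1 (horner^~ 0)).
  by rewrite !hornerE => /eqP; rewrite oner_eq0.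
move=> z a wz; apply/eqP; apply: contrapT => /negP a0.
have Jc b : J ((polyC \o d \o c) b) = h b by rewrite /J /= eval_atC jd.
have [M intz] := integral_subalg Jc intu (ysP z).
have [N [t H]] : exists N t, (u ^+ M * (d a)%:P) ^+ N = (1 + 'X * u) * t.
  apply: dvd_of_integral kx' intz _.
  by rewrite mulrCA wz [RHS]rmorphM rmorphXn /= eval_atC jd.
apply: not_dvd_const u0 _ H; apply/eqP => /kd a0'; by rewrite a0' eqxx in a0.
Qed.

(** * Prime ideals avoiding a multiplicative set *)

Local Obligation Tactic := idtac.

Section IdealOf.
Variables (C : comPzRingType) (Q : C -> Prop).
Hypotheses (Q0 : Q 0) (QD : forall x y, Q x -> Q y -> Q (x + y))
  (QM : forall a x, Q x -> Q (a * x)).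

Program Definition ideal_of : ideal C := @Ideal C [pred x | `[< Q x >]] _ _ _.
Next Obligation. by apply/asboolP. Qed.
Next Obligation. by move=> x y /asboolP ? /asboolP ?; apply/asboolP/QD. Qed.
Next Obligation. by move=> a x /asboolP ?; apply/asboolP/QM. Qed.

Lemma ideal_ofP x : x \in ideal_of <-> Q x.
Proof. by split=> [/asboolP|?]; last apply/asboolP. Qed.
End IdealOf.

Lemma exists_ideal_adjoin (C : comPzRingType) (I : ideal C) (w : C) :
  exists J : ideal C, forall z, z \in J <-> exists2 a, a \in I & exists c, z = a + c * w.
Proof.
unshelve eexists (@ideal_of _ (fun z => exists2 a, a \in I & exists c, z = a + c * w) _ _ _).
- by exists 0; [apply: ideal0 | exists 0; rewrite mul0r addr0].
- move=> _ _ [a Ia [c ->]] [b Ib [d ->]]; exists (a + b); first exact: idealD.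
  by exists (c + d); rewrite mulrDl addrACA.
- move=> b _ [a Ia [c ->]]; exists (b * a); first exact: idealMl.
  by exists (b * c); rewrite mulrDr mulrA.
- by move=> z; apply: ideal_ofP.
Qed.

(** Krull's lemma: an ideal maximal among those that contain I and avoid S is
    prime. *)
Lemma exists_prime_avoiding (C : comPzRingType) (I : ideal C) (S : C -> Prop) :
  S 1 -> (forall s t, S s -> S t -> S (s * t)) -> (forall s, s \in I -> ~ S s) ->
  exists P : ideal C,
    [/\ prime_ideal P, {subset I <= P} & forall s, s \in P -> ~ S s].
Proof.
move=> S1 SM IS.
(* The members of Q are the sets A for which the union of I and A is an ideal
   avoiding S; leaving I out of A puts the empty union, met for the empty chain,
   in Q. *)
pose Q (A : set C) := exists2 J : ideal C,
  (forall x, x \in J <-> x \in I \/ A x) & forall s, s \in J -> ~ S s.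
have [F FQ totF|A [[J JA JS] maxA]] := @Zorn_bigcup C Q.
  pose V x := x \in I \/ (exists2 X, F X & X x).
  have VD x y : V x -> V y -> V (x + y).
    have one X u v : F X -> u \in I \/ X u -> v \in I \/ X v -> V (u + v).
      move=> FX; have [J JX _] := FQ X FX.
      move=> /JX Ju /JX Jv; have /JX[Iuv|Xuv] : u + v \in J by apply: idealD.
        by left.
      by right; exists X.
    move=> [Ix|[X FX Xx]] [Iy|[Y FY Yy]].
    - by left; apply: idealD.
    - by apply: (one Y); auto.
    - by apply: (one X); auto.
    - by case: (totF X Y FX FY) => [/(_ _ Xx) Yx|/(_ _ Yy) Xy]; [apply: (one Y)|apply: (one X)]; auto.
  have VM a x : V x -> V (a * x).
    move=> [Ix|[X FX Xx]]; first by left; apply: idealMl.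
    have [J JX _] := FQ X FX; have /JX[Iax|Xax] : a * x \in J by apply/idealMl/JX; right.
      by left.
    by right; exists X.
  have V0 : V 0 by left; apply: ideal0.
  exists (ideal_of V0 VD VM) => [x|s]; first exact: ideal_ofP.
  case/ideal_ofP=> [/IS//|[X FX Xs]]; have [J JX JS] := FQ X FX.
  by apply: JS; apply/JX; right.
have adjoin w : w \notin J -> exists a c, a \in J /\ S (a + c * w).
  move=> Jw; apply: contrapT => noS.
  have [K KP] := exists_ideal_adjoin J w.
  apply: (maxA (fun z => z \in K)).
    split=> [x Ax|KA]; first by apply/KP; exists x; [apply/JA; right | exists 0; rewrite mul0r addr0].
    move/negP: Jw; apply; apply/JA; right; apply/KA/KP.
    by exists 0; [apply: ideal0 | exists 1; rewrite add0r mul1r].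
  exists K => [x|s /KP[a Ja [c ->]] Ss]; last by apply: noS; exists a, c.
  split=> [Kx|[Ix|//]]; first by right.
  by apply/KP; exists x; [apply/JA; left | exists 0; rewrite mul0r addr0].
exists J; split=> [|x Ix|//]; last by apply/JA; left.
split=> [|x y Jxy]; first by apply/negP => /JS.
have [//|Jx] := boolP (x \in J); have [//|Jy] := boolP (y \in J).
have [a [c [Ja Sx]]] := adjoin x Jx; have [b [d [Jb Sy]]] := adjoin y Jy.
case: (JS _ _ (SM _ _ Sx Sy)).
have -> : (a + c * x) * (b + d * y) = (b + d * y) * a + (c * x * b + c * d * (x * y)) by ring.
by apply: idealD; [|apply: idealD]; apply: idealMl.
Qed.

(** * Algebraic independence and chains of prime ideals *)

Section Indep.
Variable k : fieldType.

(** The iterated form k[X_0]...[X_(m-1)] of the ring of polynomials in m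
    variables lets inductions on m peel off the outermost variable X_(m-1). *)
Fixpoint mvpoly (m : nat) : idomainType :=
  if m is m'.+1 then {poly mvpoly m'} else k.

Fixpoint mvconst (m : nat) : {rmorphism k -> mvpoly m} :=
  if m is m'.+1 return {rmorphism k -> mvpoly m} then polyC \o mvconst m' else idfun.

Fixpoint mveval (C : comNzRingType) (h : {rmorphism k -> C}) (x : nat -> C) (m : nat) :
    {rmorphism mvpoly m -> C} :=
  if m is m'.+1 return {rmorphism mvpoly m -> C}
  then eval_at (mveval h x m') (x m') else h.

Lemma mveval_const (C : comNzRingType) (h : {rmorphism k -> C}) x m c :
  mveval h x m (mvconst m c) = h c.
Proof. by elim: m => //= m IH; rewrite eval_atC IH. Qed.

Lemma mveval_comp (C D : comNzRingType) (h : {rmorphism k -> C}) (h' : {rmorphism k -> D})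
    (g : {rmorphism C -> D}) x m p :
  (forall c, g (h c) = h' c) -> g (mveval h x m p) = mveval h' (g \o x) m p.
Proof.
move=> gh; elim: m p => //= m IH p.
rewrite !eval_atE -horner_map -map_poly_comp; congr (_.[_]).
exact: eq_map_poly.
Qed.

(** The classes of x 0, ..., x m.-1 in C/I are algebraically independent. *)
Definition indep_mod (C : comNzRingType) (h : {rmorphism k -> C}) (I : ideal C) x m :=
  forall p, mveval h x m p \in I -> p = 0.

Lemma indep_avoid (C : comNzRingType) (h : {rmorphism k -> C}) (I : ideal C) x m :
  indep_mod h I x m -> exists P : ideal C,
    [/\ prime_ideal P, {subset I <= P} & indep_mod h P x m].
Proof.
move=> ind; pose S s := exists2 p, p != 0 & s = mveval h x m p.
have [|s t [p p0 ->] [q q0 ->]|s Is [p p0 sp]|P [prP IP PS]] := @exists_prime_avoiding C I S.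
- by exists 1; rewrite ?oner_neq0 ?rmorph1.
- by exists (p * q); rewrite ?mulf_neq0 ?rmorphM.
- by move: p0; rewrite (ind p) ?eqxx -?sp.
- exists P; split=> // p Pp; apply/eqP; apply: contrapT => /negP p0.
  by apply: PS Pp _; exists p.
Qed.

(** [exists_generic_nondivisor], applied to C/P, gives a w outside P such that
    even P + (w) contains no nonzero polynomial in the first m elements. *)
Lemma indep_extend (C : comNzRingType) (h : {rmorphism k -> C}) (P : ideal C) x m :
  finitely_generated (KAlg h) -> 1 \notin P -> indep_mod h P x m.+1 ->
  exists J : ideal C, [/\ {subset P <= J}, exists2 w, w \in J & w \notin P & indep_mod h J x m].
Proof.
move=> [F FP] P1 ind.
have q1 : (1 : ideal_quot P) != 0.
  apply/eqP; rewrite -(rmorph0 (ideal_pi P)) -(rmorph1 (ideal_pi P)).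
  by move=> /ideal_piP; rewrite subr0; apply/negP.
pose D : comNzRingType := HB.pack (ideal_quot P) (GRing.PzSemiRing_isNonZero.Build _ q1).
pose pi : {rmorphism C -> D} := ideal_pi P.
have pi0 z : (pi z = 0) <-> (z \in P).
  by rewrite -(rmorph0 pi); split=> [/ideal_piP|?]; [|apply/ideal_piP]; rewrite subr0.
pose hD : {rmorphism k -> D} := pi \o h.
have fgD : finitely_generated (KAlg hD).
  exists [seq pi y | y <- F] => q; rewrite -[q](ideal_pi_repr (I := P)).
  elim: (FP (repr (q : ideal_quot P))) => [y Fy|c|y z _ Hy _ Hz|y z _ Hy _ Hz].
  - by apply: in_subalg_gen; apply: (map_f pi).
  - exact: (@in_subalg_const _ (KAlg hD)).
  - by rewrite rmorphD; apply: (@in_subalg_add _ (KAlg hD)).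
  - by rewrite rmorphM; apply: (@in_subalg_mul _ (KAlg hD)).
pose i := mveval hD (pi \o x) m.
have [b|p Jp|w w0 nd] := @exists_generic_nondivisor k D hD (mvpoly m) (mvconst m) i (pi (x m)) fgD.
- exact: mveval_const.
- by apply: ind; apply/pi0; rewrite (@mveval_comp _ _ h hD).
have [J JP] := exists_ideal_adjoin P (repr (w : ideal_quot P)).
have piw : pi (repr (w : ideal_quot P)) = w by exact: ideal_pi_repr.
exists J; split.
- by move=> z Pz; apply/JP; exists z => //; exists 0; rewrite mul0r addr0.
- exists (repr (w : ideal_quot P)).
    by apply/JP; exists 0; [apply: ideal0 | exists 1; rewrite mul1r add0r].
  by apply: contraNN w0 => /pi0; rewrite piw => ->.
move=> p /JP[a /pi0 Pa [c pE]]; apply: (nd (pi c)).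
rewrite -(@mveval_comp _ _ h hD) // pE rmorphD rmorphM Pa add0r piw; exact: mulrC.
Qed.

(** One independent element is given up at each step of the chain, in exchange
    for a strictly larger prime. *)
Lemma chain_of_indep (C : comNzRingType) (h : {rmorphism k -> C}) (I : ideal C) x m :
  finitely_generated (KAlg h) -> indep_mod h I x m ->
  exists2 P : 'I_m.+1 -> ideal C, prime_chain P & {subset I <= P ord0}.
Proof.
move=> fg; elim: m I => [|m IH] I ind; have [P0 [prP0 IP0 indP0]] := indep_avoid ind.
  by exists (fun _ => P0) => //; split=> // i j; rewrite !ord1.
have [J [PJ [w Jw Pw] indJ]] := indep_extend fg prP0.1 indP0.
have [P [prP chP] JP] := IH J indJ.
exists (fun i => if unlift ord0 i is Some i' then P i' else P0); last first.
  by rewrite unlift_none.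
split=> [i|i j]; first by case: unliftP.
case: (unliftP ord0 i) => [i' ->|->]; case: (unliftP ord0 j) => [j' ->|->] //.
  by rewrite /= /bump !leq0n !add1n ltnS; apply: chP.
move=> _; have PjP : {subset J <= P j'}.
  move=> z /JP Pz; have [j0|j0] := posnP j'; last by apply: (chP ord0 j' j0).1.
  by have -> : j' = ord0 by apply/val_inj.
by split=> [z /PJ/PjP//|]; exists w => //; apply: PjP.
Qed.

(** The element x m is chosen in P_(d-m) but not in P_(d-m-1).  Then x 0, ...,
    x m.-1 are independent modulo P_(d-m): if p = X^s (q + X r), with q nonzero
    and free of X, lies in P_(d-m-1) after evaluation at x, so does q + X r, and then q lies in
    P_(d-m), where the induction hypothesis applies. *)
Lemma indep_of_chain (C : comNzRingType) (h : {rmorphism k -> C}) d (P : 'I_d.+1 -> ideal C) :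
  prime_chain P -> exists x, forall p, mveval h x d p = 0 -> p = 0.
Proof.
move=> [prP chP].
have /choice[x xP] (m : nat) : exists x, (m < d)%N ->
    x \in P (inord (d - m)) /\ x \notin P (inord (d - m.+1)).
  have [md|] := ltnP m d; last by exists 0.
  have [|_ [x Px P'x]] := chP (inord (d - m.+1)) (inord (d - m)).
    by rewrite !inordK ?ltnS ?leq_subr // ltn_sub2l.
  by exists x.
suff ind m : (m <= d)%N -> indep_mod h (P (inord (d - m))) x m.
  exists x => p p0; apply: (ind d) => //; rewrite p0; exact: ideal0.
elim: m => [_|m IH md] p /=.
  move=> Pp; apply/eqP; apply: contraT => p0.
  have [/negP[]] := prP (inord (d - 0)).
  by rewrite -(rmorph1 h) -(mulVf p0) rmorphM; apply: idealMl.
move: (prP (inord (d - m.+1))) (xP m md) => [P1 Pmul] [Px P'x].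
have sub : {subset P (inord (d - m.+1)) <= P (inord (d - m))}.
  by apply: (chP _ _ _).1; rewrite !inordK ?ltnS ?leq_subr // ltn_sub2l.
elim/poly_ind: p => [//|p c IHp] Pp.
have c0 : c = 0.
  apply: (IH (ltnW md)); move/sub: Pp.
  rewrite rmorphD rmorphM eval_atC eval_atX => Pp.
  set e := mveval h x m c in Pp *; set f := eval_at _ _ _ in Pp.
  have -> : e = (f * x m + e) + (- f) * x m by ring.
  by apply: idealD => //; apply: idealMl.
rewrite c0 addr0 IHp ?mul0r //; move: Pp.
rewrite c0 rmorph0 addr0 rmorphM eval_atX => /Pmul/orP[] //.
by rewrite (negbTE P'x).
Qed.

End Indep.

(** * Monotonicity of the Krull dimension *)

(** Polynomial rings have coefficients in nontrivial rings only, whereas the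
    algebras considered here may be zero; rings with a Krull dimension are
    not. *)
Definition comNzRing_of (R : comPzRingType) (nz : (1 : R) != 0) : comNzRingType :=
  HB.pack R (GRing.PzSemiRing_isNonZero.Build R nz).

Lemma comNzRing_ofE R nz : @comNzRing_of R nz = R :> comPzRingType.
Proof. case: R nz => T [*]; reflexivity. Qed.

Lemma kalg_nontrivial (k : fieldType) (A : kalg k) :
  (1 : A) != 0 -> exists (C : comNzRingType) (h : {rmorphism k -> C}), A = KAlg h.
Proof.
case: A => R h nz; have RC := esym (comNzRing_ofE nz).
by move: (comNzRing_of nz) RC => C /= RC; subst R; exists C, h.
Qed.

Lemma krull_dim_nontrivial (R : comPzRingType) d : has_krull_dim R d -> (1 : R) != 0.
Proof.
move=> [[P [prP _]] _]; have [P1 _] := prP ord0.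
by apply: contraNneq P1 => ->; apply: ideal0.
Qed.

(** Independent elements taken from a chain in A have independent images in E,
    hence so are their preimages in B, which carry a chain of the same length.
    Finite generation matters: the polynomial ring k[x] embeds in the field
    k(x), whose dimension is 0. *)
Lemma krull_dim_mono (k : fieldType) (A B E : kalg k) (f : khom A E) (g : khom B E) d e :
  injective f -> (forall a, exists b, g b = f a) -> finitely_generated B ->
  has_krull_dim A d -> has_krull_dim B e -> (d <= e)%N.
Proof.
move=> injf fg fgB dA dB.
have nzA := krull_dim_nontrivial dA; have nzB := krull_dim_nontrivial dB.
have nzE : (1 : E) != 0.
  by apply: contraNneq nzA => E10; apply/eqP/injf; rewrite rmorph1 rmorph0.
have [A' [hA eA]] := kalg_nontrivial nzA; have [B' [hB eB]] := kalg_nontrivial nzB.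
have [E' [hE eE]] := kalg_nontrivial nzE; subst A B E.
have [[P chP] _] := dA; have [x indx] := indep_of_chain hA chP.
have /choice[y yP] (n : nat) : exists b, g b = f (x n) by apply: fg.
have indy : indep_mod hB (@ker B' E' g) y d.
  move=> p; rewrite inE => /eqP gp; apply: indx; apply: injf; rewrite rmorph0 -gp.
  rewrite (@mveval_comp _ A' E' hA hE f x) ?(@mveval_comp _ B' E' hB hE g y); first 1 last.
  - exact: (khom_map g).
  - exact: (khom_map f).
  by congr (mveval _ _ _ _); apply: funext => n /=; rewrite yP.
by have [Q chQ _] := chain_of_indep fgB indy; apply: dB.2 chQ.
Qed.

(** * Growth of polynomials *)

Lemma lead_coef_ge0 (p : {poly rat}) N :
  (forall i, (N <= i)%N -> 0 <= p.[i%:R]) -> 0 <= lead_coef p.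
Proof.
move=> p_ge0; rewrite leNgt; apply/negP => lp.
have [|b bP] := @poly_pinfty_gt_lc _ (- p); first by rewrite lead_coefN oppr_gt0.
pose i := maxn N (Num.bound `|b|).
have := bP i%:R; rewrite hornerN lead_coefN lerN2 => H.
have: p.[i%:R] <= lead_coef p.
  apply: H; apply: le_trans (ler_norm b) _; apply/ltW/(lt_le_trans (archi_boundP (normr_ge0 b))).
  by rewrite ler_nat leq_maxr.
by rewrite leNgt (lt_le_trans lp) // p_ge0 // leq_maxl.
Qed.

(** The polynomial q(X + m) has the size and the leading coefficient of q, and
    its difference with p is eventually nonnegative. *)
Lemma size_lead_coef_le (p q : {poly rat}) m N :
  (forall i, (N <= i)%N -> 0 <= p.[i%:R] <= q.[(m + i)%:R]) ->
  (size p <= size q)%N /\ (size p = size q -> lead_coef p <= lead_coef q).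
Proof.
move=> pq; pose r := q \Po ('X + m%:R%:P).
have sX : size ('X + (m%:R : rat)%:P) = 2 by rewrite size_XaddC.
have sr : size r = size q by rewrite /r size_comp_poly2.
have lr : lead_coef r = lead_coef q.
  by rewrite /r lead_coef_comp ?sX // lead_coefXaddC expr1n mulr1.
have rE i : r.[i%:R] = q.[(m + i)%:R].
  by rewrite horner_comp hornerD hornerX hornerC natrD addrC.
have p0 : 0 <= lead_coef p by apply: (@lead_coef_ge0 _ N) => i /pq/andP[].
have rp : 0 <= lead_coef (r - p).
  by apply: (@lead_coef_ge0 _ N) => i /pq/andP[_]; rewrite hornerD hornerN rE subr_ge0.
split=> [|spq].
  rewrite leqNgt -sr; apply/negP => srp.
  move: rp; rewrite addrC lead_coefDl ?size_polyN // lead_coefN oppr_ge0 => p0'.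
  have /eqP : lead_coef p = 0 by apply: le_anti; rewrite p0' p0.
  by rewrite lead_coef_eq0 -size_poly_eq0; case: (size p) srp.
rewrite -lr leNgt; apply/negP => lrp.
have c0 : (r - p)`_(size p).-1 < 0.
  by rewrite coefB {1}spq -sr -!lead_coefE subr_lt0.
have srp : size (r - p) = size p.
  apply/eqP; rewrite eqn_leq; apply/andP; split.
    by apply: leq_trans (size_polyD _ _) _; rewrite size_polyN sr spq maxnn.
  have pp : (0 < size p)%N.
    rewrite size_poly_gt0; apply: contraTneq lrp => pz.
    have -> : r = 0 by apply/eqP; rewrite -size_poly_eq0 sr -spq pz size_poly0.
    by rewrite pz ltxx.
  by rewrite -(prednK pp) ltnNge; apply/negP => rs; rewrite nth_default ?ltxx in c0.
by move: rp; rewrite lead_coefE srp leNgt c0.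
Qed.

(** * Subalgebras and quotients *)

Section SubalgebraFacts.
Variables (k : fieldType).

Lemma in_subalg_sub (A : kalg k) (X Y : A -> Prop) z :
  (forall x, X x -> in_subalg Y x) -> in_subalg X z -> in_subalg Y z.
Proof.
move=> XY; elim=> [x /XY //|c|x y _ Hx _ Hy|x y _ Hx _ Hy].
- exact: in_subalg_const.
- exact: in_subalg_add.
- exact: in_subalg_mul.
Qed.

Lemma in_subalg_opp (A : kalg k) (X : A -> Prop) z : in_subalg X z -> in_subalg X (- z).
Proof.
move=> Xz; rewrite -mulN1r -(rmorphN1 (kalg_map A)).
by apply: in_subalg_mul => //; apply: in_subalg_const.
Qed.

Lemma in_subalg_im (A B : kalg k) (f : khom A B) (X : A -> Prop) (Y : B -> Prop) z :
  (forall x, X x -> in_subalg Y (f x)) -> in_subalg X z -> in_subalg Y (f z).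
Proof.
move=> XY; elim=> [x /XY //|c|x y _ Hx _ Hy|x y _ Hx _ Hy].
- by rewrite khom_map; apply: in_subalg_const.
- by rewrite rmorphD; apply: in_subalg_add.
- by rewrite rmorphM; apply: in_subalg_mul.
Qed.

Lemma finitely_generated_surj (A B : kalg k) (f : khom A B) :
  (forall b, exists a, f a = b) -> finitely_generated A -> finitely_generated B.
Proof.
move=> surj [F FP]; exists [seq f x | x <- F] => b; have [a <-] := surj b.
by apply: in_subalg_im (FP a) => x Fx; apply: in_subalg_gen; apply: map_f.
Qed.

Lemma tens_in_subalg (I : Type) (A : I -> kalg k) (B : kalg k) (f : khom (tensor A) B)
    (Y : B -> Prop) z :
  (forall i a, in_subalg Y (f (tin A i a))) -> in_subalg Y (f z).
Proof.
move=> H; elim/tens_ind: z => [c|i a|x y|x|x y] //.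
- by rewrite khom_map; apply: in_subalg_const.
- by rewrite rmorphD; apply: in_subalg_add.
- by rewrite rmorphN; apply: in_subalg_opp.
- by rewrite rmorphM; apply: in_subalg_mul.
Qed.

Lemma bc_in_subalg (tau : {rmorphism k -> k}) (A B : kalg k) (f : khom (base_change tau A) B)
    (Y : B -> Prop) z :
  (forall a, in_subalg Y (f (bc_left tau a))) -> in_subalg Y (f z).
Proof.
move=> H.
have Hc c : in_subalg Y (f (kalg_map (base_change tau A) c)).
  by rewrite khom_map; apply: in_subalg_const.
apply: (@tens_ind _ _ (bc_factors tau A) (fun z => in_subalg Y (f (z : base_change tau A)))).
- move=> c; rewrite -(khom_map (tin (bc_factors tau A) false)); exact: Hc.
- by case=> a; [apply: H | apply: Hc].
- by move=> x y; rewrite rmorphD; apply: in_subalg_add.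
- by move=> x; rewrite rmorphN; apply: in_subalg_opp.
- by move=> x y; rewrite rmorphM; apply: in_subalg_mul.
Qed.

Lemma quot_lift (A E : kalg k) (f : khom A E) (I : ideal A) :
  (forall x, x \in I <-> f x = 0) ->
  exists2 g : khom (@KAlg k (ideal_quot I) (@ideal_pi A I \o kalg_map A)) E,
    forall x, g (ideal_pi I x) = f x & injective g.
Proof.
move=> If.
pose g0 (q : ideal_quot I) : E := f (repr q).
have g0p x : g0 (ideal_pi I x) = f x.
  apply/eqP; rewrite -subr_eq0 -rmorphB; apply/eqP/If/ideal_piP; exact: ideal_pi_repr.
have pr (q : ideal_quot I) : exists x, q = ideal_pi I x.
  by exists (repr q); rewrite ideal_pi_repr.
have g0A : zmod_morphism g0.
  by move=> q r; have [[x ->] [y ->]] := (pr q, pr r); rewrite -rmorphB !g0p rmorphB.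
have g0M : monoid_morphism g0.
  split=> [|q r]; first by rewrite -(rmorph1 (ideal_pi I)) g0p rmorph1.
  by have [[x ->] [y ->]] := (pr q, pr r); rewrite -rmorphM !g0p rmorphM.
pose ma := GRing.isZmodMorphism.Build _ _ g0 g0A.
pose mm := GRing.isMonoidMorphism.Build _ _ g0 g0M.
pose g1 : {rmorphism ideal_quot I -> E} := HB.pack g0 ma mm.
have g1c c : g1 (ideal_pi I (kalg_map A c)) = kalg_map E c by rewrite [LHS]g0p khom_map.
exists (@KHom _ (@KAlg k (ideal_quot I) (@ideal_pi A I \o kalg_map A)) E g1 g1c) => //=.
move=> q r; have [[x ->] [y ->]] := (pr q, pr r).
rewrite !g0p => fxy; apply/ideal_piP/If; by rewrite rmorphB fxy subrr.
Qed.

End SubalgebraFacts.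

(** * Prolongations and Zariski closures *)

Section Sigma.
Variables (n : nat) (k : fieldType) (sigma : sigma_ops n k).

Definition mon_mul (s t : mon n) : mon n := [ffun i => (s i + t i)%N].

Lemma mon_ordM s t : mon_ord (mon_mul s t) = (mon_ord s + mon_ord t)%N.
Proof. by rewrite /mon_ord -big_split; apply: eq_bigr => i _; rewrite ffunE. Qed.

Lemma mon_actM (R : comPzRingType) (s : sigma_ops n R) t u x :
  mon_act s (mon_mul t u) x = mon_act s t (mon_act s u x).
Proof.
have H := @mon_act_rec n R s (fun t => mon_act s (mon_mul t u) x).
rewrite H => [|j v]; first by congr (mon_act _ _ (mon_act _ _ _)); apply/ffunP=> i; rewrite !ffunE.
rewrite -mon_act_mul; congr (mon_act _ _ _); apply/ffunP=> i.
by rewrite !ffunE addnAC.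
Qed.

Section Prolongation.
Variables (A : kalg k) (R : sigma_alg sigma) (a : khom A R).

(** The subalgebra V_m of R; for the point a of GG given by an embedding of G it
    is the coordinate ring of G[m], see [zariski_kalg_embed]. *)
Definition prolongation (m : nat) : R -> Prop :=
  in_subalg (fun z : R => exists2 tau : mon n, (mon_ord tau <= m)%N &
    exists r, z = mon_act (sa_op R) tau (a r)).

Lemma prolongation_mono m m' z : (m <= m')%N -> prolongation m z -> prolongation m' z.
Proof.
move=> mm'; apply: in_subalg_sub => _ [tau tm [r ->]].
by apply: in_subalg_gen; exists tau; [apply: leq_trans mm' | exists r].
Qed.

Lemma prolongation_mon_act m tau z :
  prolongation m z -> prolongation (mon_ord tau + m) (mon_act (sa_op R) tau z).
Proof.
elim=> [_ [t tm [r ->]]|c|x y _ Hx _ Hy|x y _ Hx _ Hy].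
- apply: in_subalg_gen; exists (mon_mul tau t); last by exists r; rewrite mon_actM.
  by rewrite mon_ordM leq_add2l.
- by rewrite sa_mon_map; apply: in_subalg_const.
- by rewrite rmorphD; apply: in_subalg_add.
- by rewrite rmorphM; apply: in_subalg_mul.
Qed.

End Prolongation.

(** The index m is the one at which V'_m contains the images of the finitely many
    generators of A. *)
Lemma prolongation_shift (A A' : kalg k) (R : sigma_alg sigma) (a : khom A R) (a' : khom A' R) :
  finitely_generated A -> (forall z, exists m, prolongation a' m z) ->
  exists m, forall i z, prolongation a i z -> prolongation a' (m + i) z.
Proof.
move=> [F FP] ex.
have [m mF] : exists m, forall r, r \in F -> prolongation a' m (a r).
  elim: F {FP} => [|r F [m IH]]; first by exists 0.
  have [m' Hm'] := ex (a r); exists (maxn m m') => s; rewrite inE => /predU1P[->|/IH].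
    by apply: prolongation_mono Hm'; apply: leq_maxr.
  by apply: prolongation_mono; apply: leq_maxl.
exists m => i z; apply: in_subalg_sub => _ [tau ti [r ->]].
apply: (@prolongation_mono _ _ _ (mon_ord tau + m)); first by rewrite addnC leq_add2l.
by apply: prolongation_mon_act; apply: in_subalg_im (FP r) => s /mF.
Qed.

Section Closure.
Variables (G : sigma_group sigma) (GG : alg_group k).
Variable e : sigma_group_hom G (sigma_of_alg_group sigma GG).

Let A := ag_coord GG.
Let R := sg_coord G.

(** The universal point of G, seen as a point of GG through the embedding. *)
Definition generating_point : khom A R := khom_comp (sgh_dual e) (coord_all_univ sigma A).

Definition zariski_map i : khom (coord_le sigma A i) R :=
  khom_comp (sgh_dual e) (coord_le_in sigma A i).

Lemma dual_kgen tau r :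
  sgh_dual e (kgen sigma (A := A) tau r) = mon_act (sa_op R) tau (generating_point r).
Proof. rewrite kgen_mon; exact: (sigma_hom_mon (sgh_dual e) tau (kgen sigma (mon1 n) r)). Qed.

Lemma zariski_mapP i z : (exists y, zariski_map i y = z) <-> prolongation generating_point i z.
Proof.
split=> [[y <-]|].
  apply: tens_in_subalg => t b.
  apply: (@bc_in_subalg _ _ _ _ (khom_comp (zariski_map i) (tin _ t))) => r.
  apply: in_subalg_gen; exists (val t); first exact: (valP t).
  by exists r; rewrite -dual_kgen /= [coord_le_in _ _ _ _]tens_lift_in.
elim=> [_ [tau ti [r ->]]|c|_ _ _ [x <-] _ [y <-]|_ _ _ [x <-] _ [y <-]].
- pose t : {t : mon n | (mon_ord t <= i)%N} := exist _ tau ti.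
  exists (tin (fun t : {t : mon n | (mon_ord t <= i)%N} => factor sigma A (val t)) t (bc_left _ r)).
  by rewrite -dual_kgen /= [coord_le_in _ _ _ _]tens_lift_in.
- by exists (kalg_map _ c); rewrite khom_map.
- by exists (x + y); rewrite rmorphD.
- by exists (x * y); rewrite rmorphM.
Qed.

(** There are finitely many monomials of order at most i: their exponents are
    bounded by i, whence the enumeration by functions to 'I_i.+1. *)
Lemma coord_le_fg i : finitely_generated (coord_le sigma A i).
Proof.
have [F FP] := ag_coord_fg GG.
pose T := {t : mon n | (mon_ord t <= i)%N}.
pose fac (t : T) := factor sigma A (val t).
pose mk (v : {ffun 'I_n -> 'I_i.+1}) : option T := insub [ffun j => val (v j)].
pose ts : seq T := pmap mk (enum {: {ffun 'I_n -> 'I_i.+1}}).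
have tsP t : t \in ts.
  rewrite mem_pmap; apply/mapP; exists [ffun j => inord (val t j)]; rewrite ?mem_enum //.
  rewrite /mk; have -> : [ffun j => val ([ffun j => inord (val t j)] j : 'I_i.+1)] = val t.
    apply/ffunP=> j; rewrite !ffunE /= inordK // ltnS.
    by apply: leq_trans (valP t); rewrite /mon_ord (bigD1 j) //= leq_addr.
  by rewrite valK.
exists [seq tin fac t (bc_left _ r) | t <- ts, r <- F] => y.
rewrite -[y]/(khom_id _ y); apply: tens_in_subalg => t b.
apply: (@bc_in_subalg _ _ _ _ (khom_comp (khom_id _) (tin fac t))) => r /=.
elim: (FP r) => [s Fs|c|s s' _ Hs _ Hs'|s s' _ Hs _ Hs'].
- by apply: in_subalg_gen; apply/allpairsPdep; exists t, s.
- by rewrite bc_left_map (khom_map (tin fac t)); apply: in_subalg_const.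
- by rewrite !rmorphD; apply: in_subalg_add.
- by rewrite !rmorphM; apply: in_subalg_mul.
Qed.

Definition zariski_kalg i : kalg k :=
  @KAlg k (zariski_closure_coord e i) (ideal_pi _ \o kalg_map (coord_le sigma A i)).

Lemma zariski_kalg_fg i : finitely_generated (zariski_kalg i).
Proof.
pose p := @KHom k (coord_le sigma A i) (zariski_kalg i) (ideal_pi _) (fun c => erefl).
apply: (finitely_generated_surj (f := p)) (coord_le_fg i) => q.
by exists (repr (q : ideal_quot _)); apply: ideal_pi_repr.
Qed.

Lemma zariski_kalg_embed i : exists2 f : khom (zariski_kalg i) R, injective f &
  forall z, (exists q, f q = z) <-> prolongation generating_point i z.
Proof.
have [|g gp injg] := @quot_lift k _ _ (zariski_map i)
  (ideal_preim (coord_le_in sigma A i) (vanishing_ideal e)).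
  by move=> x; rewrite !inE; split=> /eqP.
exists g => // z; rewrite -zariski_mapP; split=> [[q <-]|[y <-]].
  by exists (repr (q : ideal_quot _)); rewrite -gp; congr (g _); apply: ideal_pi_repr.
exists (ideal_pi _ y); exact: (gp y).
Qed.

Lemma prolongation_exhaust : sigma_closed_embedding e ->
  forall z, exists m, prolongation generating_point m z.
Proof.
move=> /sigma_closed_embeddingP surj z; have [x <-] := surj z.
have [i [y <-]] := coord_le_in_surj (x : coord_all sigma (ag_coord GG)).
by exists i; apply/zariski_mapP; exists y.
Qed.

End Closure.

Lemma dimension_shift (G : sigma_group sigma) (GG GG' : alg_group k)
    (e : sigma_group_hom G (sigma_of_alg_group sigma GG))
    (e' : sigma_group_hom G (sigma_of_alg_group sigma GG')) :
  sigma_closed_embedding e' ->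
  exists m, forall i d d', has_krull_dim (zariski_closure_coord e i) d ->
    has_krull_dim (zariski_closure_coord e' (m + i)) d' -> (d <= d')%N.
Proof.
move=> he'.
have [m mP] := prolongation_shift (generating_point e) (ag_coord_fg GG) (prolongation_exhaust he').
exists m => i d d' di di'.
have [f injf fP] := zariski_kalg_embed e i; have [g _ gP] := zariski_kalg_embed e' (m + i).
apply: (krull_dim_mono (g := g)) injf _ (zariski_kalg_fg e' (m + i)) di di' => q.
by apply/gP/mP/fP; exists q.
Qed.

Lemma dimension_polynomial_le (G : sigma_group sigma) (GG GG' : alg_group k)
    (e : sigma_group_hom G (sigma_of_alg_group sigma GG))
    (e' : sigma_group_hom G (sigma_of_alg_group sigma GG')) (phi phi' : {poly rat}) :
  sigma_closed_embedding e' ->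
  is_dimension_polynomial e phi -> is_dimension_polynomial e' phi' ->
  (size phi <= size phi')%N /\ (size phi = size phi' -> lead_coef phi <= lead_coef phi').
Proof.
move=> he' [N NP] [N' NP']; have [m mP] := dimension_shift e he'.
apply: (@size_lead_coef_le _ _ m (maxn N N')) => i; rewrite geq_max => /andP[Ni N'i].
have [d dd ->] := NP i Ni; have [|d' dd' ->] := NP' (m + i)%N.
  exact: leq_trans N'i (leq_addl _ _).
by rewrite ler0n ler_nat; apply: mP dd dd'.
Qed.

End Sigma.

Theorem lemma8p10 (n : nat) (hn : (0 < n)%N) (k : fieldType) (sigma : sigma_ops n k)
    (G : sigma_group sigma) (GG GG' : alg_group k)
    (e : sigma_group_hom G (sigma_of_alg_group sigma GG))
    (e' : sigma_group_hom G (sigma_of_alg_group sigma GG'))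
    (he : sigma_closed_embedding e) (he' : sigma_closed_embedding e')
    (phi phi' : {poly rat})
    (hphi : is_dimension_polynomial e phi) (hphi' : is_dimension_polynomial e' phi') :
  size phi = size phi' /\ lead_coef phi = lead_coef phi'.
Proof.
have [s1 l1] := dimension_polynomial_le he' hphi hphi'.
have [s2 l2] := dimension_polynomial_le he hphi' hphi.
have s : size phi = size phi' by apply/eqP; rewrite eqn_leq s1 s2.
by split=> //; apply: le_anti; rewrite l1 // l2.
Qed.
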